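(* Let $R$ be a Prüfer domain of finite Krull dimension, and let $x_1,\dots,x_n$ be indeterminates over $R$. Then $R[x_1,\dots,x_n]$ is (locally) Cohen-Macaulay in the sense of Hamilton-Marley; that is, the localization of $R[x_1,\dots,x_n]$ at each of its prime ideals is Cohen-Macaulay, and $R[x_1,\dots,x_n]$ itself is Cohen-Macaulay. In particular, $V[x_1,\dots,x_n]$ is Cohen-Macaulay if $V$ is a valuation domain.
   Context: All rings are commutative with unity. Let $A$ be a ring and $\underline{a} = a_1,\dots,a_\ell$ a sequence of elements of $A$; write $\underline{a}^n = a_1^n,\dots,a_\ell^n$. Koszul complexes: $\mathbb{K}_\bullet(\underline{a})$ denotes the Koszul complex of $\underline{a}$ over $A$. For $n\ge m$ let $\varphi^n_m:\mathbb{K}_\bullet(\underline{a}^n)\to\mathbb{K}_\bullet(\underline{a}^m)$ be the natural chain map, namely the tensor product over $i=1,\dots,\ell$ of the chain maps $\mathbb{K}_\bullet(a_i^n)\to \mathbb{K}_\bullet(a_i^m)$ that are the identity in degree $0$ and multiplication by $a_i^{n-m}$ in degree $1$. Weakly proregular: $\underline{a}$ is weakly proregular if for each $m>0$ there is $n\ge m$ such that $H_i(\varphi^n_m): H_i(\mathbb{K}_\bullet(\underline{a}^n))\to H_i(\mathbb{K}_\bullet(\underline{a}^m))$ is zero for all $i\ge 1$. Čech cohomology: for an $A$-module $M$, $H^i_{\underline{a}}(M)$ is the $i$-th cohomology of the Čech complex $0\to M\to\bigoplus_i M_{a_i}\to\bigoplus_{i<j}M_{a_ia_j}\to\cdots\to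 M_{a_1\cdots a_\ell}\to 0$ (with $M$ in degree $0$). Parameter sequence: $\underline{a}$ is a parameter sequence on $A$ if (1) $(\underline{a})A\ne A$; (2) $\underline{a}$ is weakly proregular; (3) $H^\ell_{\underline{a}}(A)_{\mathfrak p}\neq 0$ for every prime ideal $\mathfrak p$ of $A$ containing $(\underline{a})A$. It is a strong parameter sequence on $A$ if $a_1,\dots,a_i$ is a parameter sequence on $A$ for all $1\le i\le \ell$. Cohen-Macaulay (Hamilton-Marley): a ring $A$ is Cohen-Macaulay if every strong parameter sequence on $A$ is a regular sequence on $A$. *)

(* Defs.v *)
From HB Require Import structures.
From mathcomp Require Import all_boot all_algebra boolp ring.
From mathcomp Require Export mpoly.

Set Implicit Arguments.
Unset Strict Implicit.
Unset Printing Implicit Defensive.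

Import GRing.Theory.
Local Open Scope ring_scope.
Local Open Scope quotient_scope.

Section QuotientModule.
Variables (A : comNzRingType) (M : lmodType A) (N : submodClosed M).

Definition submod_pred : {pred M} := [pred x | x \in N].

Lemma submod_pred_zmod : zmod_closed submod_pred.
Proof.
split=> [|x y]; rewrite !inE ?rpred0 // => Nx Ny.
by rewrite rpredD // -scaleN1r rpredZ.
Qed.
HB.instance Definition _ := GRing.isZmodClosed.Build M submod_pred
  submod_pred_zmod.

Definition quotmod : Type := @Quotient.quot M submod_pred.
HB.instance Definition _ := GRing.Zmodule.on quotmod.

Definition quotmod_class (x : M) : quotmod :=
  \pi_(@Quotient.quot M submod_pred) x.

Lemma quotmod_classW (P : quotmod -> Prop) :
  (forall x, P (quotmod_class x)) -> forall v, P v.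
Proof. by move=> Px v; rewrite -[v]reprK; apply: Px. Qed.

Lemma quotmod_classP (x y : M) :
  quotmod_class x = quotmod_class y <-> x - y \in N.
Proof.
have -> : (x - y \in N) = (x - y \in (submod_pred : {pred M})) by [].
by rewrite Quotient.idealrBE; split=> [/eqP|/eqP].
Qed.

Lemma quotmod_class_is_zmod : zmod_morphism quotmod_class.
Proof. exact: raddfB. Qed.
HB.instance Definition _ := GRing.isZmodMorphism.Build M quotmod quotmod_class
  quotmod_class_is_zmod.

Definition quotmod_repr (x : quotmod) : M :=
  @repr M (@Quotient.quot M submod_pred) x.

Lemma quotmod_reprK : cancel quotmod_repr quotmod_class.
Proof. exact: reprK. Qed.

Definition quotmod_scale (c : A) (x : quotmod) : quotmod :=
  quotmod_class (c *: quotmod_repr x).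

Lemma quotmod_scaleE c x :
  quotmod_scale c (quotmod_class x) = quotmod_class (c *: x).
Proof.
by apply/quotmod_classP; rewrite -scalerBr rpredZ //;
   apply/quotmod_classP; rewrite quotmod_reprK.
Qed.

Lemma quotmod_scaleA a b v :
  quotmod_scale a (quotmod_scale b v) = quotmod_scale (a * b) v.
Proof. by elim/quotmod_classW: v => v; rewrite !quotmod_scaleE scalerA. Qed.

Lemma quotmod_scale1 : left_id 1 quotmod_scale.
Proof. by elim/quotmod_classW => v; rewrite !quotmod_scaleE scale1r. Qed.

Lemma quotmod_scaleDr : right_distributive quotmod_scale +%R.
Proof.
move=> a; elim/quotmod_classW => u; elim/quotmod_classW => v.
by rewrite -raddfD !quotmod_scaleE scalerDr raddfD.
Qed.

Lemma quotmod_scaleDl v : {morph quotmod_scale^~ v : a b / a + b}.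
Proof.
by move=> a b; elim/quotmod_classW: v => v;
   rewrite !quotmod_scaleE scalerDl raddfD.
Qed.

HB.instance Definition _ := GRing.Zmodule_isLmodule.Build A quotmod
  quotmod_scaleA quotmod_scale1 quotmod_scaleDr quotmod_scaleDl.

Lemma quotmod_class_is_scalable : scalable quotmod_class.
Proof. by move=> c x; rewrite -quotmod_scaleE. Qed.
HB.instance Definition _ := GRing.isScalable.Build A M quotmod *:%R
  quotmod_class quotmod_class_is_scalable.

End QuotientModule.

Section Homology.
Variables (A : comNzRingType) (M1 M2 M3 : lmodType A).
Variables (f : {linear M1 -> M2}) (g : {linear M2 -> M3}).

Definition kernel : {pred M2} := [pred x | g x == 0].

Lemma kernel_submod : submod_closed kernel.
Proof.
split=> [|a x y]; rewrite !inE ?linear0 //.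
by move=> /eqP gx /eqP gy; rewrite linearP gx gy scaler0 addr0.
Qed.
HB.instance Definition _ := GRing.isSubmodClosed.Build A M2 kernel
  kernel_submod.

Definition cycles : Type := {x : M2 | x \in kernel}.
HB.instance Definition _ := SubChoice.on cycles.
HB.instance Definition _ := [SubChoice_isSubLmodule of cycles by <:].

Definition boundaries : {pred cycles} :=
  [pred z | `[< exists y, f y = \val z >]].

Lemma boundaries_submod : submod_closed boundaries.
Proof.
split=> [|a x y]; rewrite !inE.
  by apply/asboolP; exists 0; rewrite !linear0.
move=> /asboolP[u fu] /asboolP[v fv]; apply/asboolP; exists (a *: u + v).
by rewrite !linearP fu fv.
Qed.
HB.instance Definition _ := GRing.isSubmodClosed.Build A cycles boundaries
  boundaries_submod.

(* No hypothesis g \o f = 0 is needed to form ker g / (im f :&: ker g). *)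
Definition homology : Type := quotmod boundaries.
HB.instance Definition _ := GRing.Lmodule.on homology.

Definition hclass (x : M2) (gx0 : x \in kernel) : homology :=
  quotmod_class boundaries (Sub x gx0).

End Homology.

Arguments boundaries {A M1 M2 M3} f g _.

Section HomologyMap.
Variables (A : comNzRingType) (M1 M2 M3 N1 N2 N3 : lmodType A).
Variables (f : {linear M1 -> M2}) (g : {linear M2 -> M3}).
Variables (f' : {linear N1 -> N2}) (g' : {linear N2 -> N3}).
Variable phi : {linear M2 -> N2}.
Hypothesis phi_kernel : forall x, g x = 0 -> g' (phi x) = 0.

Lemma cycles_map_subproof (z : cycles g) : phi (\val z) \in kernel g'.
Proof. by rewrite inE; apply/eqP/phi_kernel/eqP; apply: (valP z). Qed.

Definition cycles_map (z : cycles g) : cycles g' :=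
  Sub (phi (\val z)) (cycles_map_subproof z).

Definition homology_map (h : homology f g) : homology f' g' :=
  quotmod_class (boundaries f' g') (cycles_map (quotmod_repr h)).

Lemma homology_mapE (phi1 : M1 -> N1) :
  (forall x, phi (f x) = f' (phi1 x)) ->
  forall z, homology_map (quotmod_class _ z) = quotmod_class _ (cycles_map z).
Proof.
move=> comm z; apply/quotmod_classP; rewrite inE; apply/asboolP.
have /quotmod_classP := quotmod_reprK (quotmod_class (boundaries f g) z).
rewrite inE => /asboolP[y fy]; exists (phi1 y).
by rewrite -comm fy !raddfB.
Qed.

End HomologyMap.
Arguments homology_map {A M1 M2 M3 N1 N2 N3 f g f' g'} phi phi_kernel h.

Section Localization.
Variables (A : comNzRingType) (S : mulrClosed A).

Record denom :=
  Denom { denom_val :> GRing.PzSemiRing.sort A; denomP : denom_val \in S }.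
HB.instance Definition _ := [isSub for denom_val].
HB.instance Definition _ := [Choice of denom by <:].

Definition denom1 : denom := Denom (rpred1 S).
Definition denomM (s t : denom) : denom := Denom (rpredM (denomP s) (denomP t)).

Lemma denomME s t : denom_val (denomM s t) = s * t. Proof. by []. Qed.

Variable M : lmodType A.
Local Notation "a *: m" := (@GRing.scale A M a m) : ring_scope.

Definition loc_rel (x y : M * denom) : bool :=
  `[< exists u : denom, u *: (y.2 *: x.1) = u *: (x.2 *: y.1) >].

Lemma loc_rel_equiv : equiv_class_of loc_rel.
Proof.
split=> [x|x y|y x z]; first by apply/asboolP; exists denom1.
  by apply/asboolP/asboolP => -[u e]; exists u; rewrite e.
case: x y z => [n t] [m s] [p r].
move=> /asboolP[u /= e1] /asboolP[v /= e2]; apply/asboolP.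
exists (denomM (denomM u v) s) => /=.
transitivity ((v * r) *: (u *: (s *: n))).
  by rewrite !scalerA; congr (_ *: _); ring.
rewrite e1.
transitivity ((u * t) *: (v *: (r *: m))).
  by rewrite !scalerA; congr (_ *: _); ring.
by rewrite e2 !scalerA; congr (_ *: _); ring.
Qed.

Implicit Types (m n : M) (s t : denom).

Canonical loc_rel_equiv_rel := EquivRelPack loc_rel_equiv.

Definition loc : Type := {eq_quot loc_rel}.
HB.instance Definition _ := Choice.on loc.

Definition locfrac (m : M) (s : denom) : loc := \pi_({eq_quot loc_rel}) (m, s).
Definition loc_repr (x : loc) : M * denom := @repr _ {eq_quot loc_rel} x.

Lemma loc_reprK x : locfrac (loc_repr x).1 (loc_repr x).2 = x.
Proof. by rewrite /locfrac -surjective_pairing; exact: reprK. Qed.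

Lemma locfracP m s n t : locfrac m s = locfrac n t <->
  exists u : denom, u *: (t *: m) = u *: (s *: n).
Proof.
rewrite /locfrac; split=> [/eqmodP/asboolP//|h].
by apply/eqmodP/asboolP.
Qed.

Lemma locfracW (P : loc -> Prop) :
  (forall m s, P (locfrac m s)) -> forall x, P x.
Proof. by move=> PP x; rewrite -[x]loc_reprK. Qed.

Lemma loc_repr_frac m s : exists u : denom,
  u *: (s *: (loc_repr (locfrac m s)).1) =
  u *: ((loc_repr (locfrac m s)).2 *: m).
Proof. by apply/locfracP; rewrite loc_reprK. Qed.

Definition loc_zero : loc := locfrac 0 denom1.
Definition loc_opp (x : loc) : loc :=
  locfrac (- (loc_repr x).1) (loc_repr x).2.
Definition loc_add (x y : loc) : loc :=
  let: (m, s) := loc_repr x in let: (n, t) := loc_repr y in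
  locfrac (t *: m + s *: n) (denomM s t).
Definition loc_scale (c : A) (x : loc) : loc :=
  locfrac (c *: (loc_repr x).1) (loc_repr x).2.

Lemma loc_oppE m s : loc_opp (locfrac m s) = locfrac (- m) s.
Proof.
apply/locfracP; have [u e] := loc_repr_frac m s.
by exists u; rewrite !scalerN e.
Qed.

Lemma loc_scaleE c m s : loc_scale c (locfrac m s) = locfrac (c *: m) s.
Proof.
apply/locfracP; have [u e] := loc_repr_frac m s; exists u.
transitivity (c *: (u *: (s *: (loc_repr (locfrac m s)).1))).
  by rewrite !scalerA; congr (_ *: _); ring.
by rewrite e !scalerA; congr (_ *: _); ring.
Qed.

Lemma loc_addE m s n t : loc_add (locfrac m s) (locfrac n t) =
  locfrac (t *: m + s *: n) (denomM s t).
Proof.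
rewrite /loc_add.
have := loc_repr_frac m s; have := loc_repr_frac n t.
case: (loc_repr (locfrac m s)) => m' s' /=.
case: (loc_repr (locfrac n t)) => n' t' /= [v ev] [u eu].
apply/locfracP; exists (denomM u v) => /=; rewrite !scalerDr.
congr (_ + _).
  transitivity ((v * t * t') *: (u *: (s *: m'))).
    by rewrite !scalerA; congr (_ *: _); ring.
  by rewrite eu !scalerA; congr (_ *: _); ring.
transitivity ((u * s * s') *: (v *: (t *: n'))).
  by rewrite !scalerA; congr (_ *: _); ring.
by rewrite ev !scalerA; congr (_ *: _); ring.
Qed.

Lemma locfrac_eq m s n t :
  t *: m = s *: n -> locfrac m s = locfrac n t.
Proof. by move=> e; apply/locfracP; exists denom1; rewrite e. Qed.

Lemma loc_addA : associative loc_add.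
Proof.
elim/locfracW => m s; elim/locfracW => n t; elim/locfracW => p r.
rewrite !loc_addE; apply: locfrac_eq; rewrite /= !scalerDr !scalerA !addrA.
by congr (_ *: _ + _ *: _ + _ *: _); ring.
Qed.

Lemma loc_addC : commutative loc_add.
Proof.
elim/locfracW => m s; elim/locfracW => n t; rewrite !loc_addE.
by apply: locfrac_eq; rewrite /= addrC mulrC.
Qed.

Lemma loc_add0 : left_id loc_zero loc_add.
Proof.
elim/locfracW => m s; rewrite loc_addE; apply: locfrac_eq.
by rewrite /= scaler0 add0r scale1r mul1r.
Qed.

Lemma loc_addN : left_inverse loc_zero loc_opp loc_add.
Proof.
elim/locfracW => m s; rewrite loc_oppE loc_addE; apply: locfrac_eq.
by rewrite /= scalerN addNr !scaler0.
Qed.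

HB.instance Definition _ :=
  GRing.isZmodule.Build loc loc_addA loc_addC loc_add0 loc_addN.

Lemma locfracD m s n t :
  locfrac m s + locfrac n t = locfrac (t *: m + s *: n) (denomM s t).
Proof. exact: loc_addE. Qed.

Lemma loc_scaleA a b v : loc_scale a (loc_scale b v) = loc_scale (a * b) v.
Proof. by elim/locfracW: v => m s; rewrite !loc_scaleE scalerA. Qed.

Lemma loc_scale1 : left_id 1 loc_scale.
Proof. by elim/locfracW => m s; rewrite loc_scaleE scale1r. Qed.

Lemma loc_scaleDr : right_distributive loc_scale +%R.
Proof.
move=> a; elim/locfracW => m s; elim/locfracW => n t.
rewrite locfracD !loc_scaleE locfracD; apply: locfrac_eq => /=.
by rewrite !scalerDr !scalerA; congr (_ *: _ + _ *: _); ring.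
Qed.

Lemma loc_scaleDl v : {morph loc_scale^~ v : a b / a + b}.
Proof.
move=> a b; elim/locfracW: v => m s.
rewrite !loc_scaleE locfracD; apply: locfrac_eq => /=.
by rewrite !scalerA -!scalerDl scalerA; congr (_ *: _); ring.
Qed.

HB.instance Definition _ := GRing.Zmodule_isLmodule.Build A loc
  loc_scaleA loc_scale1 loc_scaleDr loc_scaleDl.

Lemma locfracZ c m s : @GRing.scale A loc c (locfrac m s) = locfrac (c *: m) s.
Proof. exact: loc_scaleE. Qed.

End Localization.

Section LocalizationRing.
Variables (A : comNzRingType) (S : mulrClosed A).

Definition locring : Type := loc S A^o.
HB.instance Definition _ := GRing.Zmodule.on locring.

Implicit Types (m n : A^o) (s t : denom S) (x y : locring).

Let regE (a b : A) : a *: (b : A^o) = a * b. Proof. by []. Qed.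

Definition locring_one : locring := locfrac (1 : A^o) (denom1 S).
Definition locring_mul x y : locring :=
  let: (m, s) := loc_repr x in let: (n, t) := loc_repr y in
  locfrac (m * n : A^o) (denomM s t).

Lemma locring_mulE m s n t : locring_mul (locfrac m s) (locfrac n t) =
  locfrac (m * n : A^o) (denomM s t).
Proof.
rewrite /locring_mul.
have := loc_repr_frac m s; have := loc_repr_frac n t.
case: (loc_repr (locfrac m s)) => m' s' /=.
case: (loc_repr (locfrac n t)) => n' t' /= [v ev] [u eu].
apply/locfracP; exists (denomM u v) => /=.
rewrite !regE in ev eu *.
transitivity ((u * (s * m')) * (v * (t * n'))); first by ring.
by rewrite ev eu; ring.
Qed.

Lemma locring_mulA : associative locring_mul.
Proof.
elim/locfracW => m s; elim/locfracW => n t; elim/locfracW => p r.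
by rewrite !locring_mulE; apply: locfrac_eq; rewrite !regE /=; ring.
Qed.

Lemma locring_mulC : commutative locring_mul.
Proof.
elim/locfracW => m s; elim/locfracW => n t.
by rewrite !locring_mulE; apply: locfrac_eq; rewrite !regE /=; ring.
Qed.

Lemma locring_mul1 : left_id locring_one locring_mul.
Proof.
elim/locfracW => m s.
by rewrite !locring_mulE; apply: locfrac_eq; rewrite !regE /=; ring.
Qed.

Lemma locring_mulDl : left_distributive locring_mul +%R.
Proof.
elim/locfracW => m s; elim/locfracW => n t; elim/locfracW => p r.
rewrite locfracD !locring_mulE locfracD.
by apply: locfrac_eq; rewrite !regE /=; ring.
Qed.

HB.instance Definition _ := GRing.Zmodule_isComPzRing.Build locring
  locring_mulA locring_mulC locring_mul1 locring_mulDl.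

End LocalizationRing.

Section LocalizationAtPrime.
Variables (A : comNzRingType) (P : prime_idealr A).

Definition prime_compl : {pred A} := [pred x | x \notin P].

Lemma prime_compl_mul : mulr_closed prime_compl.
Proof.
split=> [|x y]; rewrite !inE ?idealr1 // => Px Py.
by rewrite prime_idealrM negb_or Px.
Qed.
HB.instance Definition _ := GRing.isMulClosed.Build A prime_compl
  prime_compl_mul.

Definition locprime : Type := locring prime_compl.
HB.instance Definition _ := GRing.ComPzRing.on locprime.

Lemma locprime_nonzero : 1 != 0 :> locprime.
Proof.
apply/eqP => /locfracP[u]; rewrite !scale1r scaler0 => /eqP; apply/negP.
apply: contraTneq (denomP u); rewrite [_ *: _]mulr1 => ->.
by rewrite inE negbK idealr0.
Qed.
HB.instance Definition _ := GRing.PzSemiRing_isNonZero.Build locprime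
  locprime_nonzero.

Definition modloc_prime (M : lmodType A) : Type := loc prime_compl M.
HB.instance Definition _ (M : lmodType A) := GRing.Lmodule.on (modloc_prime M).

End LocalizationAtPrime.

Section LocalizationMap.
Variables (A : comNzRingType) (S T : mulrClosed A) (M : lmodType A).
Hypothesis dvdST : forall s, s \in S -> exists u, u * s \in T.

Definition locmap_mult (s : denom S) : A := xchoose (dvdST (denomP s)).

Definition locmap_denom (s : denom S) : denom T :=
  Denom (xchooseP (dvdST (denomP s))).

Lemma locmap_denomE s : denom_val (locmap_denom s) = locmap_mult s * s.
Proof. by []. Qed.

(* The natural map: m / s = (u m) / (u s) with u s \in T. *)
Definition locmap (x : loc S M) : loc T M :=
  locfrac (locmap_mult (loc_repr x).2 *: (loc_repr x).1)
    (locmap_denom (loc_repr x).2).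

Lemma locmapE m s :
  locmap (locfrac m s) = locfrac (locmap_mult s *: m) (locmap_denom s).
Proof.
rewrite /locmap; have := loc_repr_frac m s.
case: (loc_repr (locfrac m s)) => m' s' /= [u e].
apply/locfracP; exists (locmap_denom u); rewrite !locmap_denomE.
transitivity (locmap_mult u * locmap_mult s * locmap_mult s' *:
   (denom_val u *: (denom_val s *: m'))).
  by rewrite !scalerA; congr (_ *: _); ring.
by rewrite e !scalerA; congr (_ *: _); ring.
Qed.

Lemma locmap_is_linear : linear locmap.
Proof.
move=> c; elim/locfracW => m s; elim/locfracW => n t.
rewrite locfracZ locfracD !locmapE locfracZ locfracD.
apply: locfrac_eq; rewrite !(denomME, locmap_denomE) !scalerDr !scalerA.
by congr (_ *: _ + _ *: _); ring.
Qed.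
HB.instance Definition _ := GRing.isLinear.Build A (loc S M) (loc T M) *:%R
  locmap locmap_is_linear.

End LocalizationMap.

Section DependentProduct.
Variables (A : comNzRingType) (I : finType) (V : I -> lmodType A).

Definition dprod : Type := {dffun forall i : I, V i}.
HB.instance Definition _ := Choice.on dprod.

Definition dprod_zero : dprod := [ffun i : I => 0 : V i].
Definition dprod_opp (x : dprod) : dprod := [ffun i : I => - x i : V i].
Definition dprod_add (x y : dprod) : dprod := [ffun i : I => x i + y i : V i].
Definition dprod_scale (c : A) (x : dprod) : dprod :=
  [ffun i : I => c *: x i : V i].

Lemma dprod_addA : associative dprod_add.
Proof. by move=> x y z; apply/ffunP => i; rewrite !ffunE addrA. Qed.
Lemma dprod_addC : commutative dprod_add.
Proof. by move=> x y; apply/ffunP => i; rewrite !ffunE addrC. Qed.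
Lemma dprod_add0 : left_id dprod_zero dprod_add.
Proof. by move=> x; apply/ffunP => i; rewrite !ffunE add0r. Qed.
Lemma dprod_addN : left_inverse dprod_zero dprod_opp dprod_add.
Proof. by move=> x; apply/ffunP => i; rewrite !ffunE addNr. Qed.
HB.instance Definition _ :=
  GRing.isZmodule.Build dprod dprod_addA dprod_addC dprod_add0 dprod_addN.

Lemma dprod_scaleA a b v :
  dprod_scale a (dprod_scale b v) = dprod_scale (a * b) v.
Proof. by apply/ffunP => i; rewrite !ffunE scalerA. Qed.
Lemma dprod_scale1 : left_id 1 dprod_scale.
Proof. by move=> v; apply/ffunP => i; rewrite !ffunE scale1r. Qed.
Lemma dprod_scaleDr : right_distributive dprod_scale +%R.
Proof. by move=> a u v; apply/ffunP => i; rewrite !ffunE scalerDr. Qed.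
Lemma dprod_scaleDl v : {morph dprod_scale^~ v : a b / a + b}.
Proof. by move=> a b; apply/ffunP => i; rewrite !ffunE scalerDl. Qed.
HB.instance Definition _ := GRing.Zmodule_isLmodule.Build A dprod
  dprod_scaleA dprod_scale1 dprod_scaleDr dprod_scaleDl.

Lemma dprodD (x y : dprod) i : (x + y) i = x i + y i.
Proof. exact: ffunE. Qed.
Lemma dprodZ c (x : dprod) i : (c *: x) i = c *: x i.
Proof. exact: ffunE. Qed.

End DependentProduct.

Section Simplices.
Variable l : nat.

Record simplex (i : nat) :=
  Simplex { simplex_set :> {set 'I_l}; simplexP : #|simplex_set| == i }.
HB.instance Definition _ i := [isSub for @simplex_set i].
HB.instance Definition _ i := [Finite of simplex i by <:].

(* For J = I + {j}, the sign (-1)^#{k in I | k < j}. *)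
Definition incidence (A : pzRingType) (I J : {set 'I_l}) : A :=
  if (I \subset J) && (#|J| == #|I|.+1)
  then (-1) ^+ #|[set k in I | [exists j in J :\: I, (k < j)%N]]| else 0.

End Simplices.

Section Koszul.
Variables (A : comNzRingType) (l : nat).
Implicit Types (a : l.-tuple A).

(* The i-th exterior power of A^l: x I is the coefficient of
   e_k1 /\ ... /\ e_ki, where I = {k1 < ... < ki}. *)
Definition koszul (i : nat) : lmodType A := {ffun simplex l i -> A^o}.

(* e_J |-> \sum_(p in J) (-1)^#{k in J | k < p} a_p e_(J - {p}); the map is zero
   unless i = j + 1, which takes care of both ends of the complex. *)
Definition koszul_d a (i j : nat) (x : koszul i) : koszul j :=
  [ffun I : simplex l j => \sum_(J : simplex l i)
    incidence A I J * (\prod_(k in J :\: I) tnth a k) * x J].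

Lemma koszul_d_is_linear a i j : linear (koszul_d a (i := i) j).
Proof.
move=> c x y; apply/ffunP => I; rewrite !ffunE scaler_sumr -big_split /=.
by apply: eq_bigr => J _; rewrite !ffunE mulrDr; congr (_ + _); exact: mulrCA.
Qed.
HB.instance Definition _ a i j := GRing.isLinear.Build A (koszul i) (koszul j)
  *:%R (koszul_d a j) (koszul_d_is_linear a j).

Definition koszul_homology a (i : nat) : lmodType A :=
  homology [the {linear _ -> _} of @koszul_d a i.+1 i]
           [the {linear _ -> _} of @koszul_d a i i.-1].

Definition powseq a (n : nat) : l.-tuple A := [tuple of [seq x ^+ n | x <- a]].

(* The tensor product over k of the maps K(a_k^n) -> K(a_k^m), in degree i. *)
Definition koszul_map a (m n i : nat) (x : koszul i) : koszul i :=
  [ffun I : simplex l i => (\prod_(k in I) tnth a k ^+ (n - m)) * x I].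

Lemma koszul_map_is_linear a m n i : linear (koszul_map a m n (i := i)).
Proof.
move=> c x y; apply/ffunP => I; rewrite !ffunE mulrDr; congr (_ + _).
exact: mulrCA.
Qed.
HB.instance Definition _ a m n i := GRing.isLinear.Build A (koszul i) (koszul i)
  *:%R (koszul_map a m n (i := i)) (koszul_map_is_linear a m n (i := i)).

Lemma koszul_map_d a m n i j (x : koszul i) : (m <= n)%N ->
  koszul_d (powseq a m) j (koszul_map a m n x) =
  koszul_map a m n (koszul_d (powseq a n) j x).
Proof.
move=> le_mn; apply/ffunP => I; rewrite !ffunE big_distrr /=.
apply: eq_bigr => J _; rewrite !ffunE /incidence.
case: ifP => [/andP[sIJ _]|_]; last by rewrite !mul0r mulr0.
rewrite [\prod_(k in J) _](big_setID I) [J :&: I](setIidPr sIJ).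
have -> : \prod_(k in J :\: I) tnth (powseq a n) k =
  \prod_(k in J :\: I) tnth (powseq a m) k *
  \prod_(k in J :\: I) tnth a k ^+ (n - m).
  rewrite -big_split; apply: eq_bigr => k _.
  by rewrite !tnth_map /= -exprD subnKC.
by rewrite /=; ring.
Qed.

Lemma koszul_map_cycle a m n i (x : koszul i) : (m <= n)%N ->
  koszul_d (powseq a n) i.-1 x = 0 ->
  koszul_d (powseq a m) i.-1 (koszul_map a m n x) = 0.
Proof. by move=> /koszul_map_d -> ->; rewrite linear0. Qed.

Definition koszul_homology_map a (m n : nat) (le_mn : (m <= n)%N) (i : nat) :
    koszul_homology (powseq a n) i -> koszul_homology (powseq a m) i :=
  homology_map [the {linear koszul i -> koszul i} of @koszul_map a m n i]
    (fun x => @koszul_map_cycle a m n i x le_mn).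

Definition weakly_proregular a : Prop :=
  forall m, (0 < m)%N -> exists n, exists le_mn : (m <= n)%N,
    forall i, (0 < i)%N ->
    forall h : koszul_homology (powseq a n) i, koszul_homology_map le_mn h = 0.

End Koszul.

Section Powers.
Variables (A : comNzRingType) (b : A).

Definition powers : {pred A} := [pred x | `[< exists n, x = b ^+ n >]].

Lemma powers_mul : mulr_closed powers.
Proof.
split=> [|x y]; rewrite !inE; first by apply/asboolP; exists 0%N.
move=> /asboolP[m ->] /asboolP[n ->]; apply/asboolP.
by exists (m + n)%N; rewrite exprD.
Qed.
HB.instance Definition _ := GRing.isMulClosed.Build A powers powers_mul.

End Powers.

Section Cech.
Variables (A : comNzRingType) (l : nat) (a : l.-tuple A) (M : lmodType A).

Definition cech_loc (I : {set 'I_l}) : lmodType A :=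
  loc (powers (\prod_(k in I) tnth a k)) M.

Lemma cech_dvd (I J : {set 'I_l}) : I \subset J ->
  forall s, s \in powers (\prod_(k in I) tnth a k) ->
  exists u, u * s \in powers (\prod_(k in J) tnth a k).
Proof.
move=> sIJ s; rewrite inE => /asboolP[n ->].
exists ((\prod_(k in J :\: I) tnth a k) ^+ n).
rewrite inE; apply/asboolP; exists n.
by rewrite [in RHS](big_setID I) [J :&: I](setIidPr sIJ) /= exprMn mulrC.
Qed.

Definition cech_face (I J : {set 'I_l}) (x : cech_loc I) : cech_loc J :=
  if @idP (I \subset J) is ReflectT sIJ then locmap (cech_dvd sIJ) x else 0.

Lemma cech_face_is_linear I J : linear (@cech_face I J).
Proof.
rewrite /cech_face => c x y; case: {-}_ / idP => [sIJ|_]; first exact: linearP.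
by rewrite scaler0 addr0.
Qed.
HB.instance Definition _ I J := GRing.isLinear.Build A (cech_loc I) (cech_loc J)
  *:%R (@cech_face I J) (@cech_face_is_linear I J).

Definition cech (i : nat) : lmodType A :=
  dprod (fun I : simplex l i => cech_loc I).

(* Zero unless j = i + 1, which takes care of both ends of the complex. *)
Definition cech_d (i j : nat) (x : cech i) : cech j :=
  [ffun J : simplex l j => \sum_(I : simplex l i)
    incidence A I J *: cech_face J (x I) : cech_loc J].

Lemma cech_d_is_linear i j : linear (@cech_d i j).
Proof.
move=> c x y; apply/ffunP => J; rewrite dprodD dprodZ !ffunE.
rewrite scaler_sumr -big_split /=; apply: eq_bigr => I _.
by rewrite dprodD dprodZ linearP scalerDr !scalerA [c * _]mulrC.
Qed.
HB.instance Definition _ i j := GRing.isLinear.Build A (cech i) (cech j)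
  *:%R (@cech_d i j) (@cech_d_is_linear i j).

Definition cech_cohomology (i : nat) : lmodType A :=
  homology [the {linear cech i.-1 -> cech i} of @cech_d i.-1 i]
           [the {linear cech i -> cech i.+1} of @cech_d i i.+1].

End Cech.

Section CohenMacaulay.
Variable A : comNzRingType.

Definition ideal_gen (s : seq A) (x : A) : Prop :=
  exists c : 'I_(size s) -> A, x = \sum_(i < size s) c i * s`_i.

Definition regular_sequence (l : nat) (a : l.-tuple A) : Prop :=
  (exists x, ~ ideal_gen a x) /\
  forall (i : 'I_l) (x : A),
    ideal_gen (take i a) (tnth a i * x) -> ideal_gen (take i a) x.

Definition parameter_sequence (l : nat) (a : l.-tuple A) : Prop :=
  [/\ exists x, ~ ideal_gen a x,
      weakly_proregular a
    & forall P : prime_idealr A, (forall x, ideal_gen a x -> x \in P) ->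
        exists h : modloc_prime P (cech_cohomology a A^o l), h != 0].

Definition strong_parameter_sequence (l : nat) (a : l.-tuple A) : Prop :=
  forall i, (1 <= i <= l)%N -> parameter_sequence [tuple of take i a].

Definition cohen_macaulay : Prop :=
  forall (l : nat) (a : l.-tuple A),
    strong_parameter_sequence a -> regular_sequence a.

Definition finite_krull_dim : Prop :=
  exists d : nat, forall (k : nat) (P : 'I_k.+1 -> prime_idealr A),
    (forall i j : 'I_k.+1, (i < j)%N ->
       {subset P i <= P j} /\ ~ {subset P j <= P i}) ->
    (k <= d)%N.

End CohenMacaulay.

Section PruferValuation.
Variable R : idomainType.
Local Notation K := {fraction R}.
Local Notation "x %:F" := (@tofrac R x).

Definition submodule (J : K -> Prop) : Prop :=
  [/\ J 0, forall u v, J u -> J v -> J (u + v)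
    & forall (r : R) u, J u -> J (r%:F * u)].

Definition product (I J : K -> Prop) (z : K) : Prop :=
  exists (n : nat) (u v : 'I_n -> K),
    (forall k, I (u k) /\ J (v k)) /\ z = \sum_(k < n) u k * v k.

Definition embed (I : R -> Prop) (z : K) : Prop := exists2 x, I x & z = x%:F.

Definition invertible_ideal (I : R -> Prop) : Prop :=
  exists2 J : K -> Prop, submodule J &
    forall z, product (embed I) J z <-> embed (fun=> True) z.

Definition prufer_domain : Prop :=
  forall s : seq R, (exists2 x, x \in s & x != 0) ->
    invertible_ideal (ideal_gen s).

Definition valuation_domain : Prop :=
  forall z : K, z != 0 -> embed (fun=> True) z \/ embed (fun=> True) z^-1.

End PruferValuation.

(* Main.v *)
From HB Require Import structures.
Require Import Defs.
From mathcomp Require Import all_boot all_algebra boolp ring.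
From mathcomp Require classical_sets.

(** Let B be a localization of A = R[x_1, ..., x_n], where R is a Prufer domain,
    and let a_1, ..., a_(l+1) be a parameter sequence on B such that a_1, ...,
    a_l is regular.  Suppose that a_(l+1) y lies in (a_1, ..., a_l) but y does
    not.  Let p be a prime minimal over the ideal ((a_1, ..., a_l) : y); it
    contains every a_i, so the top cohomology H^(l+1)_a(B) is nonzero at p.
    The contradiction is that it vanishes there.  Concretely this vanishing says
    that for every n there are N >= n and u outside p with
    u (a_1 ... a_(l+1))^(N-n) in (a_1^N, ..., a_(l+1)^N)
    (kills_top, top_cech_localized_zero).

    The base is prepared first.  Local rings of R are valuation rings, and if x
    is transcendental over the residue field of q, then S[x] localized at q S[x]
    is again a valuation ring, because polynomials have contents
    (locally_val_poly).  Moving such variables into the base one by one,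
    one may assume that A = S[X_1, ..., X_d], that S is a valuation ring at
    q = p /\ S, and that each X_i is algebraic over the residue field of q, so
    that p contains a polynomial g_i(X_i) whose leading coefficient is outside p
    (top_vanishing_val).  Put e = 0 if q = 0 and e = 1 otherwise.  The vanishing
    then follows from two bounds around the number d + e.

    - Depth (depth_le): d + e <= l.  The ideal p contains a regular sequence z
      of length d + e, made of the g_i(X_i) and, if q <> 0, a nonzero constant.
      By minimality of p, suitable powers z_j^k multiply y into (a_1, ..., a_l),
      so y is a nonzero element of the top Koszul homology of z^k on
      A / (a_1, ..., a_l).  But z^k is acyclic on A, and each further regular
      a_i raises the degrees of the nonzero homology by at most one.

    - Flat dimension (weak_dim_vanishing): every module A/J has flat dimension
      at most d + e at p.  As in Hilbert's syzygy theorem, it is the quotient by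
      the regular sequence Y_i - X_i of the module (A/J)[Y_1, ..., Y_d], which
      has flat dimension at most e because torsion-free modules over a valuation
      ring are flat.  Weak proregularity says that the Koszul
      homology of the powers of a on A is pro-zero in positive degrees; this
      passes to flat modules, and costs one degree at every step of a flat
      resolution.  Since l + 1 > d + e, the top Koszul homology of A/J is
      pro-zero, with N depending on n only, so that J = (a_1^N, ...,
      a_(l+1)^N) may be chosen afterwards.  The class of 1 then gives the
      membership above.

    No module is ever localized: U is the complement of p, and all assertions
    about homology hold up to a factor in U. *)

Set Implicit Arguments.
Unset Strict Implicit.
Unset Printing Implicit Defensive.

Import GRing.Theory.
Local Open Scope ring_scope.

(** * Ideals as predicates *)

Section Ideals.
Variable D : comNzRingType.

Record ideal (I : D -> Prop) : Prop := Ideal {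
  ideal0 : I 0;
  idealD : forall x y, I x -> I y -> I (x + y);
  idealM : forall r x, I x -> I (r * x) }.

Lemma ideal_mulr I : ideal I -> forall r x, I x -> I (x * r).
Proof. by move=> idI r x Ix; rewrite mulrC; apply: idealM. Qed.

Lemma idealN I : ideal I -> forall x, I x -> I (- x).
Proof. by move=> idI x Ix; rewrite -mulN1r; apply: idealM. Qed.

Lemma idealB I : ideal I -> forall x y, I x -> I y -> I (x - y).
Proof. by move=> idI x y Ix Iy; apply: idealD => //; apply: idealN. Qed.

Lemma ideal_sum I (J : Type) (r : seq J) (P : pred J) (F : J -> D) :
  ideal I -> (forall j, P j -> I (F j)) -> I (\sum_(j <- r | P j) F j).
Proof.
by move=> idI IF; elim/big_ind: _ => //; [apply: ideal0 | apply: idealD].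
Qed.

Definition zero_ideal (x : D) : Prop := x = 0.
Definition unit_ideal (x : D) : Prop := True.

Lemma ideal_zero : ideal zero_ideal.
Proof.
by split=> [|x y -> ->|r x ->] //; rewrite /zero_ideal ?addr0 ?mulr0.
Qed.

Lemma ideal_unit : ideal unit_ideal. Proof. by []. Qed.

(** The set H of generators may be infinite; being inductive, membership in the
    ideal is proved by induction. *)
Inductive gen (H : D -> Prop) : D -> Prop :=
| gen_zero : gen H 0
| gen_cons h r x : H h -> gen H x -> gen H (h * r + x).

Lemma gen_ideal H : ideal (gen H).
Proof.
split=> [|x y Hx Hy|r x]; first exact: gen_zero.
  elim: Hx => [|h r z Hh _ IH]; rewrite ?add0r // -addrA.
  exact: gen_cons.
elim=> [|h s z Hh _ IH]; first by rewrite mulr0; apply: gen_zero.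
by rewrite mulrDr mulrCA; apply: gen_cons.
Qed.

Lemma gen_in (H : D -> Prop) h : H h -> gen H h.
Proof.
move=> Hh; rewrite -[h]mulr1 -[_ * 1]addr0.
by apply: gen_cons => //; apply: gen_zero.
Qed.

Lemma gen_min H I :
  ideal I -> (forall h, H h -> I h) -> forall x, gen H x -> I x.
Proof.
move=> idI HI x; elim=> [|h r z Hh _ IH]; first exact: ideal0.
by apply: idealD => //; apply: ideal_mulr => //; apply: HI.
Qed.

Lemma gen_mono (H H' : D -> Prop) :
  (forall h, H h -> H' h) -> forall x, gen H x -> gen H' x.
Proof.
move=> HH'; apply: (gen_min (gen_ideal H')) => h Hh.
by apply: gen_in; apply: HH'.
Qed.

Definition add_gen (I : D -> Prop) (f x : D) : Prop :=
  exists2 v, I v & exists r, x = v + f * r.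

Lemma add_gen_ideal I f : ideal I -> ideal (add_gen I f).
Proof.
move=> idI; split.
- by exists 0; [apply: ideal0 | exists 0; rewrite mulr0 addr0].
- move=> _ _ [v Iv [r ->]] [v' Iv' [r' ->]].
  by exists (v + v'); [apply: idealD | exists (r + r'); ring].
- move=> s _ [v Iv [r ->]].
  by exists (s * v); [apply: idealM | exists (s * r); ring].
Qed.

Variables (l : nat) (a : 'I_l -> D).

Definition initial (i : nat) (h : D) : Prop :=
  exists2 j : 'I_l, (j < i)%N & h = a j.

(** Quotients by these ideals are the steps of an iterated quotient by the
    sequence a, starting from the quotient by H. *)
Definition seq_ideal (H : D -> Prop) (i : nat) : D -> Prop :=
  gen (fun h => H h \/ initial i h).

Lemma seq_idealS H (i : 'I_l) :
  seq_ideal H i.+1 = add_gen (seq_ideal H i) (a i).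
Proof.
apply/funext => x; apply/propext; split.
  apply: gen_min; first by apply/add_gen_ideal/gen_ideal.
  have in_add h : H h \/ initial i h -> add_gen (seq_ideal H i) (a i) h.
    by move=> Hh; exists h; [exact: gen_in | exists 0; rewrite mulr0 addr0].
  move=> h [Hh|[j ji ->]]; first by apply: in_add; left.
  move: ji; rewrite ltnS leq_eqVlt => /orP[/eqP/val_inj->|ji].
    by exists 0; [apply: gen_zero | exists 1; rewrite add0r mulr1].
  by apply: in_add; right; exists j.
move=> [v Hv [r ->]]; apply: idealD; first exact: gen_ideal.
  apply: gen_mono Hv => h [Hh|[j ji ->]]; first by left.
  by right; exists j => //; apply: leqW.
apply: ideal_mulr; first exact: gen_ideal.
by apply: gen_in; right; exists i.
Qed.

Lemma seq_ideal0 H : ideal H -> seq_ideal H 0 = H.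
Proof.
move=> idH; apply/funext => x; apply/propext; split; last first.
  by move=> Hx; apply: gen_in; left.
by apply: gen_min idH _ x => h [//|[j]]; rewrite ltn0.
Qed.

Lemma seq_ideal_zero i : seq_ideal zero_ideal i = gen (initial i).
Proof.
apply/funext => x; apply/propext; split; last first.
  by apply: gen_mono => h; right.
apply: gen_min (gen_ideal _) _ x => h [->|hi]; last exact: gen_in.
exact: gen_zero.
Qed.

Lemma initial0 x : gen (initial 0) x -> x = 0.
Proof. by apply: (gen_min ideal_zero) => h [j]; rewrite ltn0. Qed.

Lemma genP (x : D) : gen (initial l) x <-> exists c, x = \sum_i c i * a i.
Proof.
split=> [|[c ->]].
  elim=> [|_ r z [j _ ->] _ [c ->]].
    by exists (fun=> 0); rewrite big1 // => i _; rewrite mul0r.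
  exists (fun i => (if i == j then r else 0) + c i).
  under [RHS]eq_bigr do rewrite mulrDl; rewrite big_split /=; congr (_ + _).
  rewrite (bigD1 j) //= eqxx mulrC big1 ?addr0 // => i /negPf ->.
  by rewrite mul0r.
apply: ideal_sum => [|i _]; first exact: gen_ideal.
by apply: idealM; [exact: gen_ideal | apply: gen_in; exists i].
Qed.

End Ideals.

(** * Koszul complexes with coefficients in subquotients of a ring *)

Section Koszul.
Variables (D : comNzRingType) (l : nat).
Implicit Types (b : 'I_l -> D) (z w : {set 'I_l} -> D) (L : {set 'I_l}).

(** Koszul chains are functions on all subsets of the index set, the value at L
    being the coefficient of the exterior monomial e_L; the degree is kept
    apart, in khom, which avoids dependent types in the induction on degrees. *)
Definition ksign (j : 'I_l) L : D := (-1) ^+ #|[set k in L | (k < j)%N]|.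

Definition kdiff b z L : D :=
  \sum_(j | j \notin L) ksign j L * b j * z (j |: L).

Definition khom (i : nat) z : Prop := forall L, #|L| != i -> z L = 0.

Lemma ksignU j k L : j \notin L ->
  ksign k (j |: L) = (-1) ^+ (j < k)%N * ksign k L.
Proof.
move=> jL; rewrite /ksign -exprD; congr (_ ^+ _).
have -> : [set i in j |: L | (i < k)%N] =
  [set i in [set j] | (i < k)%N] :|: [set i in L | (i < k)%N].
  by apply/setP=> i; rewrite !inE andb_orl.
set J := [set i in [set j] | _]; set K := [set i in L | _].
have JK0 : J :&: K = set0.
  apply/setP=> i; rewrite !inE; case: eqP => //= ->.
  by rewrite (negPf jL) andbF.
rewrite cardsU JK0 cards0 subn0; congr (_ + _)%N.
have -> : J = if (j < k)%N then [set j] else set0.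
  by apply/setP=> i; rewrite !inE; case: ifP; rewrite !inE; case: eqP => // ->.
by case: ifP; rewrite ?cards1 ?cards0.
Qed.

(** The terms for j < k and for k < j cancel in pairs; splitting by order,
    rather than by the symmetry of the double sum, makes this valid where 2 =
    0. *)
Lemma kdiff_sq b z L : kdiff b (kdiff b z) L = 0.
Proof.
pose F j k := ksign j L * b j * (ksign k (j |: L) * b k * z (k |: (j |: L))).
have -> : kdiff b (kdiff b z) L =
  \sum_j \sum_(k | [&& j \notin L, k \notin L & j != k]) F j k.
  rewrite /kdiff (big_mkcond (fun j => j \notin L)); apply: eq_bigr => j _.
  case: ifP => [jL|_]; last by rewrite big_pred0.
  rewrite mulr_sumr; apply: eq_bigl => k; rewrite !inE negb_or [j == k]eq_sym.
  by rewrite andbC.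
have FN j k : j \notin L -> k \notin L -> (j < k)%N -> F j k + F k j = 0.
  move=> jL kL jk; rewrite /F !ksignU // jk [(k < j)%N]ltnNge (ltnW jk) /=.
  by rewrite setUCA expr1 expr0; ring.
rewrite (eq_bigr (fun j =>
  \sum_(k | [&& j \notin L, k \notin L & (j < k)%N]) F j k +
  \sum_(k | [&& j \notin L, k \notin L & (k < j)%N]) F j k)); last first.
  move=> j _; rewrite (bigID (fun k : 'I_l => (j < k)%N)) /=; congr (_ + _).
    apply: eq_bigl => k; rewrite -!andbA; do 2 case: (_ \notin L) => //=.
    by rewrite -val_eqE /=; case: ltngtP.
  apply: eq_bigl => k; rewrite -!andbA; do 2 case: (_ \notin L) => //=.
  by rewrite -val_eqE /=; case: ltngtP.
rewrite big_split /= [X in _ + X](exchange_big_dep xpredT) //= -big_split.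
rewrite big1 //= => j _; rewrite [X in _ + X](eq_bigl
  (fun k => [&& j \notin L, k \notin L & (j < k)%N])); last first.
  by move=> k; rewrite andbCA.
by rewrite -big_split big1 //= => k /and3P[jL kL jk]; apply: FN.
Qed.

Lemma kdiff_hom b i z : khom i.+1 z -> khom i (kdiff b z).
Proof.
move=> hz L Li; apply: big1 => j jL.
by rewrite hz ?mulr0 // cardsU1 jL add1n eqSS.
Qed.

Lemma kdiffD b z w L :
  kdiff b (fun L => z L + w L) L = kdiff b z L + kdiff b w L.
Proof. by rewrite /kdiff -big_split; apply: eq_bigr => j _; rewrite mulrDr. Qed.

Lemma kdiffZ b c z L : kdiff b (fun L => c * z L) L = c * kdiff b z L.
Proof. by rewrite /kdiff mulr_sumr; apply: eq_bigr => j _; rewrite mulrCA. Qed.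

Lemma kdiffB b z w L :
  kdiff b (fun L => z L - w L) L = kdiff b z L - kdiff b w L.
Proof.
rewrite -[X in _ - X]mul1r -mulNr -kdiffZ -kdiffD; apply: eq_bigr => j _.
by rewrite mulN1r.
Qed.

Lemma kdiff_sum b (J : Type) (r : seq J) (z : J -> {set 'I_l} -> D) L :
  kdiff b (fun L => \sum_(j <- r) z j L) L = \sum_(j <- r) kdiff b (z j) L.
Proof.
rewrite /kdiff exchange_big; apply: eq_bigr => j _ /=.
by rewrite mulr_sumr.
Qed.

Lemma kdiff_ideal (I : D -> Prop) b z :
  ideal I -> (forall L, I (z L)) -> forall L, I (kdiff b z L).
Proof. by move=> idI Iz L; apply: ideal_sum => // j _; apply: idealM. Qed.

Variable a : 'I_l -> D.

Definition apow (n : nat) (j : 'I_l) : D := a j ^+ n.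

(** The transition map from the complex of a^N to that of a^n, for m = N - n. *)
Definition ktrans (m : nat) z L : D := (\prod_(k in L) a k ^+ m) * z L.

Lemma ktrans_d n N z L : (n <= N)%N ->
  kdiff (apow n) (ktrans (N - n) z) L = ktrans (N - n) (kdiff (apow N) z) L.
Proof.
move=> nN; rewrite /ktrans /kdiff mulr_sumr; apply: eq_bigr => j jL.
have -> : apow N j = apow n j * a j ^+ (N - n) by rewrite -exprD subnKC.
by rewrite big_setU1 //=; ring.
Qed.

Lemma ktrans_comp n m N z L : (n <= m <= N)%N ->
  ktrans (m - n) (ktrans (N - m) z) L = ktrans (N - n) z L.
Proof.
move=> /andP[nm mN]; rewrite /ktrans mulrA -big_split /=; congr (_ * _).
by apply: eq_bigr => k _; rewrite -exprD addnC addnBA // subnK.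
Qed.

Lemma ktrans_hom i m z : khom i z -> khom i (ktrans m z).
Proof. by move=> hz L Li; rewrite /ktrans hz ?mulr0. Qed.

Lemma ktrans_ideal (I : D -> Prop) m z :
  ideal I -> (forall L, I (z L)) -> forall L, I (ktrans m z L).
Proof. by move=> idI Iz L; apply: idealM. Qed.

Lemma ktransB m z w L :
  ktrans m (fun L => z L - w L) L = ktrans m z L - ktrans m w L.
Proof. exact: mulrBr. Qed.

Lemma ktransZ c m z L : ktrans m (fun L => c * z L) L = c * ktrans m z L.
Proof. by rewrite /ktrans mulrCA. Qed.

Lemma ktrans_affine c m u z w L :
  c * ktrans m (fun L => u * z L - w L) L =
  c * u * ktrans m z L - c * ktrans m w L.
Proof. by rewrite /ktrans; ring. Qed.

Lemma ktrans0 z L : ktrans 0 z L = z L.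
Proof. by rewrite /ktrans big1 ?mul1r. Qed.

Variable U : D -> Prop.
Hypothesis U1 : U 1.
Hypothesis UM : forall u v, U u -> U v -> U (u * v).

(** Vanishing, up to U, in degrees above e, of the map from the Koszul homology
    of a^N to that of a^n, with coefficients in the module I'/I.  All modules
    that occur are subquotients of one ring, so they need not be constructed. *)
Definition pro_zero (n N e : nat) (I I' : D -> Prop) : Prop :=
  forall i z, (e < i)%N -> khom i z -> (forall L, I' (z L)) ->
    (forall L, I (kdiff (apow N) z L)) ->
  exists u w, [/\ U u, khom i.+1 w, forall L, I' (w L)
    & forall L, I (u * ktrans (N - n) z L - kdiff (apow n) w L)].

Lemma pro_zeroW n N e e' I I' :
  (e <= e')%N -> pro_zero n N e I I' -> pro_zero n N e' I I'.
Proof. by move=> ee' Z i z e'i; apply: Z; apply: leq_ltn_trans e'i. Qed.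

(** The long exact sequence of 0 -> I'/I -> I''/I -> I''/I' -> 0.  For a cycle z
    modulo I', the differential dz is a cycle in I'/I; it bounds after the first
    transition, which corrects z to a cycle modulo I, and this bounds after the
    second one. *)
Lemma pro_zero_ses n m N e I I' I'' : (n <= m <= N)%N ->
  ideal I -> ideal I' -> ideal I'' ->
  (forall x, I x -> I' x) -> (forall x, I' x -> I'' x) ->
  pro_zero m N e I I' -> pro_zero n m e.+1 I I'' -> pro_zero n N e.+1 I' I''.
Proof.
move=> /andP[nm mN] idI idI' idI'' II' I'I'' ZI' ZI'' [//|i] z ei hz zI'' dzI'.
have [|||u [w [Uu hw wI' dw]]] := ZI' i (kdiff (apow N) z) _ _ dzI'.
- by [].
- exact: kdiff_hom.
- by move=> L; rewrite kdiff_sq; apply: ideal0.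
pose z' L := u * ktrans (N - m) z L - w L.
have hz' : khom i.+1 z'.
  by move=> L Li; rewrite /z' hw // (ktrans_hom _ hz) // mulr0 subr0.
have [|||u' [w' [Uu' hw' w'I'' dw']]] := ZI'' i.+1 z' _ hz'.
- by [].
- move=> L; apply: idealB => //; last exact: I'I''.
  by apply: idealM => //; apply: ktrans_ideal.
- move=> L; rewrite /z' kdiffB kdiffZ ktrans_d //.
exists (u' * u), w'; split=> //; first exact: UM.
move=> L; have := II' _ (dw' L); rewrite /z' ktransB ktransZ ktrans_comp ?nm //.
move=> H; have -> : u' * u * ktrans (N - n) z L - kdiff (apow n) w' L =
  (u' * (u * ktrans (N - n) z L - ktrans (m - n) w L) - kdiff (apow n) w' L) +
  u' * ktrans (m - n) w L by ring.
apply: idealD => //; apply: idealM => //; exact: ktrans_ideal.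
Qed.

Lemma common_mult (J : finType) (P : J -> D -> Prop) :
  (forall j u v, P j u -> P j (v * u)) ->
  (forall j, exists2 u, U u & P j u) -> exists2 u, U u & forall j, P j u.
Proof.
move=> PM Pex.
suff [u Uu Pu] : exists2 u, U u & forall j, j \in enum J -> P j u.
  by exists u => // j; apply: Pu; rewrite mem_enum.
elim: (enum J) => [|j s [u Uu Pu]]; first by exists 1.
have [v Uv Pv] := Pex j; exists (v * u); first exact: UM.
move=> k; rewrite inE => /predU1P[->|/Pu]; last exact: PM.
by rewrite mulrC; apply: PM.
Qed.

Definition reg_mod (I : D -> Prop) (f : D) : Prop :=
  forall x : D, I (f * x) -> exists2 u, U u & I (u * x).

(** When f is regular modulo I, multiplication by f is an isomorphism from D/I
    onto (I + fD)/I, so both outer terms of 0 -> D/I -> D/I -> D/(I + fD) -> 0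
    are governed by the hypotheses on D/I. *)
Lemma pro_zero_quotient n m N e I f :
  (n <= m <= N)%N -> ideal I -> reg_mod I f ->
  pro_zero m N e I (@unit_ideal D) -> pro_zero n m e.+1 I (@unit_ideal D) ->
  pro_zero n N e.+1 (add_gen I f) (@unit_ideal D).
Proof.
move=> nmN idI fI Z1 Z2; have idf := add_gen_ideal f idI.
apply: (pro_zero_ses (m := m) (I := I)) => //; last first.
  move=> i z ei hz zI' dz.
  have /choice[v Iv] : forall L, exists v : D, I (z L - f * v).
    move=> L; have [v Iv [r zE]] := zI' L; exists r.
    by rewrite zE addrK.
  pose v' L := if #|L| == i then v L else 0.
  have Iv' L : I (z L - f * v' L).
    rewrite /v'; case: ifP => [_|/negbT Li]; first exact: Iv.
    by rewrite hz // mulr0 subr0; apply: ideal0.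
  have hv' : khom i v' by move=> L /negPf Li; rewrite /v' Li.
  have [||u Uu uv] :=
    common_mult (P := fun L u => I (u * kdiff (apow N) v' L)) _ _.
  - by move=> L u v0 H; rewrite -mulrA; apply: idealM.
  - move=> L; apply: fI; have -> : f * kdiff (apow N) v' L =
      kdiff (apow N) z L - kdiff (apow N) (fun L => z L - f * v' L) L.
      by rewrite kdiffB kdiffZ; ring.
    by apply: idealB => //; apply: kdiff_ideal.
  have [|||u' [w [Uu' hw _ dw]]] := Z1 i (fun L => u * v' L) ei _ _ _.
  - by move=> L Li; rewrite hv' ?mulr0.
  - by [].
  - by move=> L; rewrite kdiffZ.
  exists (u' * u), (fun L => f * w L); split.
  - exact: UM.
  - by move=> L Li; rewrite hw ?mulr0.
  - by move=> L; exists 0; [apply: ideal0 | exists (w L); rewrite add0r].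
  - move=> L; rewrite kdiffZ; have -> : u' * u * ktrans (N - m) z L -
      f * kdiff (apow m) w L = u' * u * ktrans (N - m) (fun L => z L - f * v' L) L
      + f * (u' * ktrans (N - m) (fun L => u * v' L) L - kdiff (apow m) w L).
      by rewrite ktransB !ktransZ; ring.
    by apply: idealD; rewrite //; apply: idealM => //; apply: ktrans_ideal.
by move=> x Ix; exists x => //; exists 0; rewrite mulr0 addr0.
Qed.

(** Weak proregularity in the form used here: nu n is an exponent that works for
    n. *)
Definition pro_acyclic (nu : nat -> nat) : Prop := forall n, (0 < n)%N ->
  (n <= nu n)%N /\ pro_zero n (nu n) 0 (@zero_ideal D) (@unit_ideal D).

(** Each class 1/(a_1 ... a_l)^n of the top Cech cohomology of a is killed by an
    element of U. *)
Definition kills_top : Prop := forall n, (0 < n)%N ->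
  exists N u, [/\ (n <= N)%N, U u
    & gen (initial (apow N) l) (u * (\prod_k a k) ^+ (N - n))].

(** Each quotient by a regular element composes two transitions, hence the 2 ^ j
    iterations.  It matters that the exponent depends on nu and j only, and not
    on H: the ideal is chosen after the exponent. *)
Lemma pro_zero_chain (H : D -> Prop) (d : nat) (f : 'I_d -> D) (nu : nat -> nat)
    (e j : nat) : (j <= d)%N ->
  (forall i : 'I_d, (i < j)%N -> reg_mod (seq_ideal f H i) (f i)) ->
  (forall n, (0 < n)%N -> (n <= nu n)%N /\
     pro_zero n (nu n) e (seq_ideal f H 0) (@unit_ideal D)) ->
  forall n, (0 < n)%N -> (n <= iter (2 ^ j) nu n)%N /\
     pro_zero n (iter (2 ^ j) nu n) (e + j) (seq_ideal f H j) (@unit_ideal D).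
Proof.
elim: j => [|j IH] ltjd freg Z n n0; first by rewrite addn0; apply: Z.
have {}IH := IH (ltnW ltjd) (fun i ij => freg i (leqW ij)) Z.
have [le_nm Znm] := IH n n0; set m := iter (2 ^ j) nu n in le_nm Znm.
have [le_mN ZmN] := IH m (leq_trans n0 le_nm).
rewrite expnS mul2n -addnn iterD -/m; split; first exact: leq_trans le_mN.
rewrite addnS (seq_idealS f H (Ordinal ltjd)).
apply: (pro_zero_quotient (m := m)) => //.
- by rewrite le_nm.
- exact: gen_ideal.
- exact: freg.
- exact: pro_zeroW Znm.
Qed.

End Koszul.

(** * Acyclicity of the Koszul complex of a regular sequence *)

Section RegularSequences.
Variables (D : comNzRingType) (l : nat).
Variable U : D -> Prop.
Hypothesis U1 : U 1.
Hypothesis UM : forall u v, U u -> U v -> U (u * v).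

Definition reg_seq (b : 'I_l -> D) : Prop :=
  forall i : 'I_l, reg_mod U (gen (initial b i)) (b i).

Variable b : 'I_l -> D.

Lemma initialP (i : nat) (x : D) : gen (initial b i) x ->
  exists2 c : 'I_l -> D, forall j : 'I_l, (i <= j)%N -> c j = 0 &
    x = \sum_j c j * b j.
Proof.
elim=> [|_ r z [j ji ->] _ [c c0 ->]].
  by exists (fun=> 0) => //; rewrite big1 // => j _; rewrite mul0r.
exists (fun k => (if k == j then r else 0) + c k).
  move=> k ik; rewrite c0 // addr0; case: eqP => // kj.
  by move: ji; rewrite -kj ltnNge ik.
under [RHS]eq_bigr do rewrite mulrDl; rewrite big_split /=; congr (_ + _).
rewrite (bigD1 j) //= eqxx mulrC big1 ?addr0 // => k /negPf ->.
by rewrite mul0r.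
Qed.

Definition ksupp (m : nat) (z : {set 'I_l} -> D) : Prop :=
  forall (L : {set 'I_l}) (j : 'I_l), j \in L -> (m <= j)%N -> z L = 0.

Lemma kdiff_supp m z : ksupp m z -> ksupp m (kdiff b z).
Proof.
move=> sz L j jL mj; apply: big1 => k _; rewrite (sz _ j) ?mulr0 //.
by rewrite !inE jL orbT.
Qed.

(** Contraction with, and exterior product by, the basis vector of the largest
    index p in use; p being last, no signs appear. *)
Definition kcontract (p : 'I_l) (z : {set 'I_l} -> D) (L : {set 'I_l}) : D :=
  if p \in L then 0 else z (p |: L).

Definition kwedge (p : 'I_l) (w : {set 'I_l} -> D) (L : {set 'I_l}) : D :=
  if p \in L then w (L :\ p) else 0.

Lemma kcontract_hom p i z : khom i.+1 z -> khom i (kcontract p z).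
Proof.
move=> hz L Li; rewrite /kcontract; case: ifP => // /negbT pL; apply: hz.
by rewrite cardsU1 pL add1n eqSS.
Qed.

Lemma kwedge_hom p i w : khom i w -> khom i.+1 (kwedge p w).
Proof.
move=> hw L Li; rewrite /kwedge; case: ifP => // pL; apply: hw.
by rewrite -eqSS -add1n -[1%N]/(nat_of_bool true) -pL -cardsD1.
Qed.

Lemma kcontract_supp (p : 'I_l) z : ksupp p.+1 z -> ksupp p (kcontract p z).
Proof.
move=> sz L j jL pj; rewrite /kcontract; case: ifP => // pL.
apply: (sz _ j); first by rewrite !inE jL orbT.
by rewrite ltn_neqAle pj andbT; apply: contraFneq pL => /val_inj ->.
Qed.

Lemma kwedge_supp (p : 'I_l) w : ksupp p w -> ksupp p.+1 (kwedge p w).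
Proof.
move=> sw L j jL pj; rewrite /kwedge; case: ifP => // pL.
apply: (sw _ j); last exact: ltnW.
by rewrite !inE jL andbT; apply: contraTneq pj => ->; rewrite ltnn.
Qed.

Lemma ksign_set0 (j : 'I_l) : ksign D j set0 = 1.
Proof.
rewrite /ksign (_ : [set k in set0 | _] = set0) ?cards0 //.
by apply/setP=> k; rewrite !inE.
Qed.

Lemma ksign_top (p j : 'I_l) (L : {set 'I_l}) : p \notin L -> (j < p)%N ->
  ksign D j (p |: L) = ksign D j L.
Proof. by move=> pL jp; rewrite ksignU // ltnNge (ltnW jp) mul1r. Qed.

Lemma kdiff_contract (p : 'I_l) z : ksupp p.+1 z -> forall L : {set 'I_l},
  kdiff b (kcontract p z) L = if p \in L then 0 else kdiff b z (p |: L).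
Proof.
move=> sz L; case: ifP => [pL|/negbT pL].
  by apply: big1 => j _; rewrite /kcontract !inE pL orbT mulr0.
rewrite /kdiff (bigD1 p) //= /kcontract !inE eqxx mulr0 add0r.
apply: eq_big => [j|j /andP[jL jp]]; first by rewrite !inE negb_or andbC.
rewrite !inE (negPf pL) orbF eq_sym (negPf jp) setUCA.
have [lt_jp|le_pj] := ltnP j p; first by rewrite ksign_top.
rewrite (sz _ j) ?mulr0 //; first by rewrite !inE eqxx.
by rewrite ltn_neqAle le_pj andbT eq_sym.
Qed.

Lemma kdiff_wedge (p : 'I_l) w : ksupp p w -> forall L : {set 'I_l}, p \in L ->
  kdiff b (kwedge p w) L = kdiff b w (L :\ p).
Proof.
move=> sw L pL; rewrite /kdiff [RHS](bigD1 p) ?inE ?eqxx //=.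
rewrite (sw _ p) ?inE ?eqxx // mulr0 add0r.
apply: eq_big => [j|j jL].
  rewrite !inE negb_and negbK; case: eqP => [->|_] /=; last by rewrite andbT.
  by rewrite pL.
have jp : j != p by apply: contraNneq jL => ->.
rewrite /kwedge !inE pL orbT.
have -> : (j |: L) :\ p = j |: (L :\ p).
  apply/setP=> k; rewrite !inE; case: (k =P j) => [->|_] //=.
  by rewrite jp.
have [lt_jp|le_pj] := ltnP j p.
  by rewrite -{1}(setD1K pL) ksign_top // !inE eqxx.
by rewrite (sw _ j) ?mulr0 // !inE eqxx.
Qed.

Hypothesis b_reg : reg_seq b.

(** Induction on the number m of basis vectors in use.  The part v of z that
    involves the last vector is a cycle of one degree less on the first m - 1
    vectors; it bounds by induction, or by regularity of b_m when its degree is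
    zero.  Subtracting the boundary of the product with the last vector removes
    it from z. *)
Lemma reg_seq_acyclic_supp (m : nat) : (m <= l)%N ->
  forall i z, khom i.+1 z -> ksupp m z -> (forall L, kdiff b z L = 0) ->
  exists u w, [/\ U u, khom i.+2 w, ksupp m w
    & forall L, u * z L = kdiff b w L].
Proof.
elim: m => [_|m IH lt_ml] i z hz sz dz.
  exists 1, (fun=> 0); split=> // L; rewrite mul1r.
  have -> : kdiff b (fun=> 0) L = 0 by apply: big1 => j _; rewrite mulr0.
  have [->|[j jL]] := set_0Vmem L; last exact: (sz _ j).
  by apply: hz; rewrite cards0.
pose p := Ordinal lt_ml; have {IH}IH := IH (ltnW lt_ml).
pose v := kcontract p z.
have hv : khom i v by apply: kcontract_hom.
have sv : ksupp p v by apply: kcontract_supp.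
have dv L : kdiff b v L = 0 by rewrite /v kdiff_contract // dz; case: ifP.
have [u [w [Uu hw sw dw]]] : exists u w, [/\ U u, khom i.+1 w, ksupp p w
    & forall L, u * v L = kdiff b w L].
  case: i hz hv => [|i] hz hv; last exact: IH.
  (* v is a constant in degree 0, and dz = 0 puts b_p v in (b_j : j < p). *)
  have [|u Uu] := @b_reg p (v set0).
    have := dz set0; rewrite /kdiff (bigD1 p) ?inE //=.
    rewrite ksign_set0 mul1r /v /kcontract inE => /eqP.
    rewrite addr_eq0 => /eqP ->.
    apply: idealN; first exact: gen_ideal.
    apply: ideal_sum => [|j /andP[_ jp]]; first exact: gen_ideal.
    have [lt_jp|le_pj] := ltnP j p.
      rewrite mulrAC; apply: idealM; first exact: gen_ideal.
      by apply: gen_in; exists j.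
    rewrite (sz _ j) ?mulr0 ?inE ?eqxx //; last first.
      by rewrite ltn_neqAle le_pj andbT eq_sym.
    exact: gen_zero.
  move=> /initialP[c c0 uv].
  exists u, (fun L => \sum_j if L == [set j] then c j else 0); split=> //.
  - move=> L L1; apply: big1 => j _; case: eqP => // LE.
    by rewrite LE cards1 in L1.
  - move=> L j jL pj; apply: big1 => k _; case: eqP => // LE; apply: c0.
    by move: jL; rewrite LE inE => /eqP <-.
  - move=> L; have [->|L0] := eqVneq L set0; last first.
      rewrite (hv L) ?cards_eq0 // mulr0; apply/esym/big1 => j jL.
      rewrite big1 ?mulr0 // => k _; case: eqP => // jLE.
      have : #|j |: L| = #|L|.+1 by rewrite cardsU1 jL.
      by rewrite jLE cards1 => -[/esym/eqP]; rewrite cards_eq0 (negPf L0).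
    rewrite uv; apply: eq_big => [j|j _]; first by rewrite inE.
    rewrite (bigD1 j) //= setU0 eqxx big1 ?addr0; last first.
      by move=> k kj; case: eqP => // /set1_inj jk; rewrite jk eqxx in kj.
    by rewrite ksign_set0 mul1r mulrC.
pose z' L := u * z L - kdiff b (kwedge p w) L.
have hz' : khom i.+1 z'.
  move=> L Li; rewrite /z' hz // mulr0.
  by rewrite (kdiff_hom b (kwedge_hom p hw)) ?subr0.
have z'p (L : {set 'I_l}) : p \in L -> z' L = 0.
  move=> pL; rewrite /z' kdiff_wedge // -dw /v /kcontract !inE eqxx setD1K //.
  by rewrite subrr.
have sz' : ksupp m z'.
  move=> L j jL; rewrite leq_eqVlt => /orP[/eqP mj|mj].
    by apply: z'p; rewrite (_ : p = j) //; apply: val_inj.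
  rewrite /z' (sz _ j) // mulr0 (kdiff_supp (m := m.+1) _ jL) ?subr0 //.
  exact: (kwedge_supp (p := p)).
have [|u' [w' [Uu' hw' sw' dw']]] := IH i z' hz' sz' _.
  by move=> L; rewrite /z' kdiffB kdiffZ dz kdiff_sq mulr0 subr0.
exists (u' * u), (fun L => w' L + u' * kwedge p w L); split.
- exact: UM.
- by move=> L Li; rewrite hw' // (kwedge_hom p hw) // mulr0 addr0.
- move=> L j jL mj; rewrite (sw' _ j) ?(ltnW mj) //.
  by rewrite (kwedge_supp (p := p) sw jL mj) mulr0 addr0.
- by move=> L; rewrite kdiffD kdiffZ -dw' /z'; ring.
Qed.

End RegularSequences.

(** Acyclicity in the pro-zero form, with n = N: there is no transition to
    make. *)
Lemma reg_seq_pro_zero (D : comNzRingType) (l : nat) (U : D -> Prop)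
    (y : 'I_l -> D) (k : nat) : U 1 -> (forall u v, U u -> U v -> U (u * v)) ->
  reg_seq U (apow y k) ->
  pro_zero y U k k 0 (@zero_ideal D) (@unit_ideal D).
Proof.
move=> U1 UM y_reg [//|i] z _ hz _ dz.
have [|u [w [Uu hw _ dw]]] :=
  reg_seq_acyclic_supp U1 UM y_reg (leqnn l) hz _ dz.
  by move=> L j _; rewrite leqNgt ltn_ord.
exists u, w; split=> // L.
by rewrite /zero_ideal subnn ktrans0 dw subrr.
Qed.

(** * Regularity of polynomials with invertible leading coefficient *)

Lemma mpoly_morph_ext (C : comNzRingType) (d : nat) (T : comNzRingType)
    (f g : {rmorphism {mpoly C[d]} -> T}) :
  (forall c, f c%:MP = g c%:MP) -> (forall i, f 'X_i = g 'X_i) -> f =1 g.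
Proof.
move=> fgC fgX w; rewrite [w]mpolyE !rmorph_sum; apply: eq_bigr => m _ /=.
rewrite -mul_mpolyC !rmorphM fgC; congr (_ * _).
rewrite mpolyXE_id !rmorph_prod.
by apply: eq_bigr => i _; rewrite !rmorphXn fgX.
Qed.

Lemma mpoly_closed_ind (C : comNzRingType) (d : nat)
    (P : {mpoly C[d]} -> Prop) :
  (forall c, P c%:MP) -> (forall i, P 'X_i) ->
  (forall v w, P v -> P w -> P (v + w)) ->
  (forall v w, P v -> P w -> P (v * w)) -> forall w, P w.
Proof.
move=> PC PX PD PM w; have P0 : P 0 by rewrite -mpolyC0; apply: PC.
have P1 : P 1 by rewrite -mpolyC1; apply: PC.
rewrite [w]mpolyE; elim/big_rec: _ => // m v _ Pv; apply: PD => //.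
rewrite -mul_mpolyC mpolyXE_id; apply: (PM) => //.
elim/big_rec: _ => // i v' _ Pv'; apply: (PM) => //.
by elim: (m i) => [|k IH]; rewrite ?expr0 // exprS; apply: PM.
Qed.

(** Induction on the size of W: the top coefficient of F W shows that the
    leading coefficient of F multiplies that of W into I, and after this
    multiplication the top term of W may be dropped. *)
Lemma poly_lead_reg (A : comNzRingType) (I : A -> Prop) (F W : {poly A}) :
  ideal I -> (forall k, I (F * W)`_k) ->
  exists K, forall k, I (lead_coef F ^+ K * W`_k).
Proof.
move=> idI; set c := lead_coef F.
have [n] := ubnP (size W); elim: n W => // n IH W; rewrite ltnS => sW IFW.
case: n IH sW => [|n] IH sW.
  exists 0%N => k; move: sW; rewrite leqn0 size_poly_eq0 => /eqP ->.
  by rewrite coef0 mulr0; apply: ideal0.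
have Itop : I (c * W`_n).
  case: (posnP (size F)) => [/eqP|sF].
    rewrite size_poly_eq0 /c => /eqP ->; rewrite lead_coef0 mul0r.
    exact: ideal0.
  pose e := (size F).-1; have sFe : size F = e.+1 by rewrite prednK.
  have := IFW (e + n)%N; rewrite coefM.
  have le_e : (e < (e + n).+1)%N by rewrite ltnS leq_addr.
  rewrite (bigD1 (Ordinal le_e)) //= addKn /c lead_coefE -/e big1 ?addr0 //.
  move=> j; rewrite -val_eqE /= neq_ltn => /orP[lt_j|lt_e].
    rewrite [W`__]nth_default ?mulr0 //; apply: leq_trans sW _.
    by rewrite ltn_subRL ltn_add2r.
  by rewrite nth_default ?mul0r // sFe.
pose W' := c *: W - (c * W`_n) *: 'X^n.
have W'E k : W'`_k = if k == n then 0 else c * W`_k.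
  rewrite coefB !coefZ coefXn; case: eqP => [->|_] /=.
    by rewrite mulr1 subrr.
  by rewrite mulr0 subr0.
have [||K HK] := IH W'.
- rewrite ltnS; apply/leq_sizeP => k; rewrite leq_eqVlt W'E eq_sym.
  case: eqP => //= _ nk; rewrite nth_default ?mulr0 //.
  exact: leq_trans nk.
- move=> k; rewrite mulrBr coefB -!scalerAr !coefZ.
  apply: idealB => //; [exact: idealM|exact: ideal_mulr].
exists K.+1 => k; have [->|nk] := eqVneq k n.
  by rewrite exprS mulrAC mulrC; apply: idealM.
by have := HK k; rewrite W'E (negPf nk) mulrA -exprSr.
Qed.

Section LeadingCoefficient.
Variables (C : comNzRingType) (d : nat) (i : 'I_d).

Definition split_var_X (j : 'I_d) : {poly {mpoly C[d]}} :=
  if j == i then 'X else ('X_j)%:P.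

(** Polynomials in all variables seen as polynomials in X_i alone, over a copy
    of the same ring in which X_i does not occur; reusing the ring of
    coefficients avoids a change of the number of variables. *)
Definition split_var : {mpoly C[d]} -> {poly {mpoly C[d]}} :=
  mmap (@polyC _ \o @mpolyC d C) split_var_X.
HB.instance Definition _ := GRing.RMorphism.on split_var.

Lemma split_varC c : split_var c%:MP = c%:MP%:P. Proof. exact: mmapC. Qed.
Lemma split_varX j : split_var 'X_j = split_var_X j.
Proof. by rewrite [LHS]mmapX mmap1U. Qed.

Lemma split_varB v w : split_var (v - w) = split_var v - split_var w.
Proof. exact: rmorphB. Qed.

Lemma split_varK w : (split_var w).['X_i] = w.
Proof.
apply: (mpoly_morph_ext (f := horner_eval 'X_i \o split_var) (g := idfun)).
  move=> c /=.
  by rewrite /horner_eval split_varC hornerC.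
move=> j /=; rewrite /horner_eval split_varX /split_var_X.
by case: eqP => [->|_]; rewrite ?hornerX ?hornerC.
Qed.

Variable U : {mpoly C[d]} -> Prop.
Hypothesis U1 : U 1.
Hypothesis UM : forall u v, U u -> U v -> U (u * v).

(** If the generators do not involve X_i, the ideal contains a polynomial as
    soon as it contains its coefficients with respect to X_i, and conversely. *)
Lemma reg_mod_lead (H : {mpoly C[d]} -> Prop) f :
  (forall h, H h -> split_var h = h%:P) -> U (lead_coef (split_var f)) ->
  reg_mod U (gen H) f.
Proof.
move=> HC Uf w Hfw; have idH := gen_ideal H.
have stab x : gen H x -> forall k, gen H (split_var x)`_k.
  elim=> [|h r y Hh _ IH] k; first by rewrite rmorph0 coef0; apply: ideal0.
  rewrite rmorphD rmorphM /= HC // coefD coefCM.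
  by apply: idealD => //; apply: ideal_mulr => //; apply: gen_in.
have [|K HK] := @poly_lead_reg _ (gen H) (split_var f) (split_var w) idH.
  by move=> k; rewrite -rmorphM; apply: stab.
exists (lead_coef (split_var f) ^+ K).
  by elim: K {HK} => [|K IH]; rewrite ?expr0 // exprS; apply: UM.
rewrite -[w in X in gen H X]split_varK horner_coef mulr_sumr.
by apply: ideal_sum => // k _; rewrite mulrA; apply: ideal_mulr.
Qed.

End LeadingCoefficient.

(** * Flatness of torsion-free modules over valuation rings *)

Definition mult_set (D : comNzRingType) (U : D -> Prop) : Prop :=
  U 1 /\ forall u v, U u -> U v -> U (u * v).

(** For V the complement of a prime q of a domain S, the local ring of S at q is
    a valuation ring. *)
Definition locally_val (S : comNzRingType) (V : S -> Prop) : Prop :=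
  forall f g, exists u h, V u /\ (u * f = h * g \/ u * g = h * f).

(** A finite family in a valuation ring has a member that divides all others. *)
Lemma locally_val_min (S : comNzRingType) (V : S -> Prop) (r : nat)
    (s : 'I_r.+1 -> S) : mult_set V -> locally_val V ->
  exists k u h, V u /\ forall j, u * s j = h j * s k.
Proof.
move=> [V1 VM] val; elim: r s => [|r IH] s.
  by exists ord0, 1, (fun=> 1); split=> // j; rewrite ord1.
have [k [u [h [Vu hk]]]] := IH (fun j => s (lift ord0 j)).
have [v [g [Vv [vE|vE]]]] := val (s ord0) (s (lift ord0 k)).
  exists (lift ord0 k), (u * v),
    (fun j => if unlift ord0 j is Some j' then v * h j' else u * g).
  split=> [|j]; first exact: VM.
  case: (unliftP ord0 j) => [j' ->|->]; last by rewrite -!mulrA vE.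
  by rewrite [u * v]mulrC -!mulrA hk.
exists ord0, (u * v),
  (fun j => if unlift ord0 j is Some j' then h j' * g else u * v).
split=> [|j]; first exact: VM.
case: (unliftP ord0 j) => [j' ->|->] //.
by rewrite [u * v]mulrC -!mulrA hk -vE; ring.
Qed.

Section KoszulMorphism.
Variables (D1 D2 : comNzRingType) (f : {rmorphism D1 -> D2}) (l : nat).
Variable a : 'I_l -> D1.
Implicit Type z : {set 'I_l} -> D1.

Lemma kdiff_morph n z L :
  kdiff (apow (f \o a) n) (f \o z) L = f (kdiff (apow a n) z L).
Proof.
rewrite /kdiff rmorph_sum; apply: eq_bigr => j _.
by rewrite !rmorphM /ksign rmorph_sign /apow rmorphXn.
Qed.

Lemma ktrans_morph m z L : ktrans (f \o a) m (f \o z) L = f (ktrans a m z L).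
Proof.
rewrite /ktrans rmorphM rmorph_prod; congr (_ * _).
by apply: eq_bigr => j _; rewrite rmorphXn.
Qed.

End KoszulMorphism.

Section Flat.
Variables (S : idomainType) (d : nat).
Local Notation A := {mpoly S[d]}.
Local Notation D := {mpoly {mpoly S[d]}[d]}.

Variable U : A -> Prop.
Hypothesis U1 : U 1.
Hypothesis UM : forall u v, U u -> U v -> U (u * v).
Hypothesis U0 : ~ U 0.

(** This condition makes the finitely generated submodules of the S-module G'/G
    free, up to U.  It holds for torsion-free modules over a valuation ring, and
    for all modules over a field. *)
Definition reducible_relations (G G' : A -> Prop) : Prop :=
  forall (r : nat) (m : 'I_r.+1 -> A) (s : 'I_r.+1 -> S),
    (forall k, G' (m k)) -> G (\sum_k s k *: m k) -> (exists k, s k != 0) ->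
  exists k u c, U u%:MP /\ G (u *: m k - \sum_(j < r) c j *: m (lift k j)).

Definition const_set : S -> Prop := fun u => U u%:MP.

Lemma const_set_mult : mult_set const_set.
Proof.
split=> [|u v Uu Uv]; rewrite /const_set ?rmorph1 // rmorphM; exact: UM.
Qed.

(** The coefficient that divides all others can be cancelled from the
    relation. *)
Lemma reducible_torsion_free (G' : A -> Prop) :
  locally_val const_set -> reducible_relations (@zero_ideal A) G'.
Proof.
move=> val r m s _ rel [k0 sk0].
have [k [u [h [Uu hk]]]] := locally_val_min s const_set_mult val.
have u0 : u != 0.
  apply: contra_notN U0 => /eqP u_eq.
  by move: Uu; rewrite /const_set u_eq rmorph0.
have sk : s k != 0.
  apply: contraNneq sk0 => sk; have := hk k0; rewrite sk mulr0 => /eqP.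
  by rewrite mulf_eq0 (negPf u0).
have hku : h k = u by apply: (mulIf sk); rewrite -hk.
exists k, u, (fun j => - h (lift k j)); split=> //; rewrite /zero_ideal.
have /eqP : (s k)%:MP * (\sum_j h j *: m j) = 0.
  rewrite mul_mpolyC.
  transitivity (u *: \sum_j s j *: m j); last by rewrite rel scaler0.
  rewrite !scaler_sumr; apply: eq_bigr => j _.
  by rewrite !scalerA [s k * _]mulrC hk.
rewrite mulf_eq0 mpolyC_eq0 (negPf sk) /= => /eqP.
rewrite (bigD1_ord k) //= hku => E; rewrite -[RHS]E; congr (_ + _).
by rewrite -sumrN; apply: eq_bigr => j _; rewrite scaleNr opprK.
Qed.

Lemma reducible_field (G G' : A -> Prop) : (forall u, u != 0 -> const_set u) ->
  reducible_relations G G'.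
Proof.
move=> fld r m s _ rel [k sk]; exists k, (s k), (fun j => - s (lift k j)).
split; first exact: fld.
rewrite -sumrN; under eq_bigr do rewrite scaleNr opprK.
by move: rel; rewrite (bigD1_ord k).
Qed.

Lemma idealZ (I : A -> Prop) (c : S) x : ideal I -> I x -> I (c *: x).
Proof. by move=> idI Ix; rewrite -mul_mpolyC; apply: idealM. Qed.

(** A spanning family of least cardinality is independent. *)
Lemma independent_family (G G' : A -> Prop) (J : finType) (m : J -> A) :
  ideal G -> ideal G' -> reducible_relations G G' -> (forall j, G' (m j)) ->
  exists (r : nat) (b : 'I_r -> A) (u : S) (c : J -> 'I_r -> S),
  [/\ forall k, G' (b k), const_set u,
      forall j, G (u *: m j - \sum_k c j k *: b k)
    & forall s : 'I_r -> S, G (\sum_k s k *: b k) -> forall k, s k = 0].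
Proof.
move=> idG idG' red mG'; have [VM1 VM] := const_set_mult.
pose P r := exists (b : 'I_r -> A) (u : S) (c : J -> 'I_r -> S),
  [/\ forall k, G' (b k), const_set u
    & forall j, G (u *: m j - \sum_k c j k *: b k)].
have exP : exists r, `[< P r >].
  exists #|J|; apply/asboolP; exists (fun k => m (enum_val k)), 1.
  exists (fun j k => (k == enum_rank j)%:R); split=> // j.
  rewrite (bigD1 (enum_rank j)) //= eqxx !scale1r enum_rankK big1 ?addr0 ?subrr.
    exact: ideal0.
  by move=> k /negPf ->; rewrite scale0r.
case: (ex_minnP exP) => r /asboolP[b [u [c [bG' Uu mb]]]] r_min.
exists r, b, u, c; split=> // s rel; apply: contrapT => /existsNP[k0 /eqP sk0].
case: r b c bG' mb r_min s rel k0 sk0 => [|r] b c bG' mb r_min s rel k0 sk0.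
  by case: k0 sk0.
have [k [v [h [Uv bk]]]] := red _ _ _ bG' rel (ex_intro _ k0 sk0).
suff : (r.+1 <= r)%N by rewrite ltnn.
apply: r_min; apply/asboolP.
exists (fun i => b (lift k i)), (v * u).
exists (fun j i => c j k * h i + v * c j (lift k i)); split=> // [|j].
  exact: VM.
have -> : (v * u) *: m j -
    \sum_i (c j k * h i + v * c j (lift k i)) *: b (lift k i)
  = v *: (u *: m j - \sum_k c j k *: b k)
    + c j k *: (v *: b k - \sum_i h i *: b (lift k i)).
  have -> : \sum_i (c j k * h i + v * c j (lift k i)) *: b (lift k i) =
    c j k *: (\sum_i h i *: b (lift k i))
    + v *: (\sum_i c j (lift k i) *: b (lift k i)).
    rewrite !scaler_sumr -big_split; apply: eq_bigr => i _.
    by rewrite /= scalerDl !scalerA.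
  rewrite (bigD1_ord k) //= !scalerBr scalerDr !scalerA [c j k * v]mulrC.
  ring.
by apply: idealD => //; apply: idealZ.
Qed.

(** D = A[Y_1, ..., Y_d] carries two copies of A = S[X_1, ..., X_d]; tau is the
    copy in the variables Y, through which A acts on D, while coefficients are
    in the variables X.  For a subquotient M of the S-module A, this makes M[Y]
    the A-module obtained from M by base change. *)
Definition tau : A -> D := map_mpoly (@mpolyC d S).
HB.instance Definition _ := GRing.RMorphism.on tau.

Lemma mcoeff_tau x m : (tau x)@_m = (x@_m)%:MP.
Proof. exact: mcoeff_map_mpoly. Qed.

Definition tau_set (v : D) : Prop := exists2 u, U u & v = tau u.

Definition coeffwise (G : A -> Prop) (w : D) : Prop := forall m, G w@_m.

Lemma coeffwise_ideal G : ideal G -> ideal (coeffwise G).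
Proof.
move=> idG; split=> [m|x y Gx Gy m|x y Gy m].
- by rewrite mcoeff0; apply: ideal0.
- by rewrite mcoeffD; apply: idealD.
- rewrite mcoeffM; apply: ideal_sum => // k _; exact: idealM.
Qed.

Lemma coeffwise_constM G (c : A) (w : D) :
  ideal G -> G c -> coeffwise G (c%:MP * w).
Proof. by move=> idG Gc m; rewrite mcoeffCM; apply: ideal_mulr. Qed.

Lemma mcoeff_const_tau (r : nat) (b x : 'I_r -> A) m :
  (\sum_k (b k)%:MP * tau (x k))@_m = \sum_k (x k)@_m *: b k.
Proof.
rewrite raddf_sum; apply: eq_bigr => k _ /=.
by rewrite mcoeffCM mcoeff_tau mulrC mul_mpolyC.
Qed.

(** The base change M[Y] of a module M = G'/G whose finitely generated
    submodules are free is flat over A, so that pro-vanishing passes from A to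
    M[Y]. A cycle with values in M[Y] involves finitely many elements of M; on
    an independent family spanning them it splits into cycles with values in
    A. *)
Lemma flat_extension (l : nat) (a : 'I_l -> A) (n N : nat) (G G' : A -> Prop) :
  ideal G -> ideal G' -> (forall x, G x -> G' x) -> reducible_relations G G' ->
  pro_zero a U n N 0 (@zero_ideal A) (@unit_ideal A) ->
  pro_zero (tau \o a) tau_set n N 0 (coeffwise G) (coeffwise G').
Proof.
move=> idG idG' GG' red Z i z i0 hz zG' dz.
have idcG := coeffwise_ideal idG; have idcG' := coeffwise_ideal idG'.
(* A degree bound turns the coefficients of z into a finite family. *)
pose K := \max_(L : {set 'I_l}) msize (z L).
have szK L : (msize (z L) <= K)%N by apply: leq_bigmax.
have [r [b [u [c [bG' Uu zb indep]]]]] :=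
  independent_family (J := ({set 'I_l} * 'X_{1..d < K})%type)
    (m := fun Lm => (z Lm.1)@_Lm.2) idG idG' red (fun Lm => zG' Lm.1 Lm.2).
pose zeta k L : A := \sum_(m : 'X_{1..d < K}) c (L, m) k *: 'X_[m].
have hzeta k : khom i (zeta k).
  move=> L Li; apply: big1 => m _; have := zb (L, m).
  rewrite /= hz // mcoeff0 scaler0 sub0r => /(idealN idG); rewrite opprK.
  by move=> /indep ->; rewrite scale0r.
have zE L : coeffwise G (tau u%:MP * z L - \sum_k (b k)%:MP * tau (zeta k L)).
  move=> m; rewrite mcoeffB mcoeff_const_tau /tau map_mpolyC.
  rewrite mcoeffCM mul_mpolyC.
  have zetaE k : (zeta k L)@_m =
      if insub m is Some m' then c (L, m' : 'X_{1..d < K}) k else 0.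
    rewrite /zeta raddf_sum /=; case: insubP => [m' _ m'E|lem].
      rewrite (bigD1 m') //= mcoeffZ mcoeffX m'E eqxx mulr1 big1 ?addr0 //.
      move=> m2 m2m'; rewrite mcoeffZ mcoeffX -m'E.
      case: eqP => [/val_inj eq2|]; last by rewrite mulr0.
      by rewrite eq2 eqxx in m2m'.
    apply: big1 => m2 _; rewrite mcoeffZ mcoeffX.
    case: eqP => [m2m|]; last by rewrite mulr0.
    by rewrite -m2m bmdeg in lem.
  under eq_bigr do rewrite zetaE; case: insubP => [m' _ <-|lem].
    exact: (zb (L, m')).
  rewrite memN_msupp_eq0; last first.
    by apply: msize_mdeg_ge; apply: leq_trans (szK L) _; rewrite leqNgt.
  rewrite scaler0 sub0r; apply: idealN => //; apply: ideal_sum => // k _.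
  by rewrite scale0r; apply: ideal0.
have sum_kdiff (x : 'I_r -> {set 'I_l} -> A) e L :
    kdiff (apow (tau \o a) e) (fun L => \sum_k (b k)%:MP * tau (x k L)) L =
    \sum_k (b k)%:MP * tau (kdiff (apow a e) (x k) L).
  rewrite kdiff_sum; apply: eq_bigr => k _; rewrite kdiffZ; congr (_ * _).
  exact: (kdiff_morph tau).
have dzeta k L : kdiff (apow a N) (zeta k) L = 0.
  apply/mpolyP => m; rewrite mcoeff0; move: k.
  apply: (indep (fun k => (kdiff (apow a N) (zeta k) L)@_m)).
  have : coeffwise G (\sum_k (b k)%:MP * tau (kdiff (apow a N) (zeta k) L)).
    rewrite -sum_kdiff.
    have -> : kdiff (apow (tau \o a) N)
        (fun L => \sum_k (b k)%:MP * tau (zeta k L)) L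
      = tau u%:MP * kdiff (apow (tau \o a) N) z L - kdiff (apow (tau \o a) N)
        (fun L => tau u%:MP * z L - \sum_k (b k)%:MP * tau (zeta k L)) L.
      by rewrite kdiffB kdiffZ; ring.
    apply: (idealB idcG); last exact: (kdiff_ideal _ idcG).
    exact: (idealM idcG).
  by move/(_ m); rewrite mcoeff_const_tau.
have [||v Uv Pv] := common_mult U1 UM (J := 'I_r) (P := fun k v =>
  exists2 w, khom i.+1 w &
    forall L, v * ktrans a (N - n) (zeta k) L = kdiff (apow a n) w L).
- move=> k v v' [w hw dw]; exists (fun L => v' * w L).
    by move=> L Li; rewrite hw ?mulr0.
  by move=> L; rewrite kdiffZ -dw mulrA.
- move=> k.
  have [//|v [w [Uv hw _ dw]]] := Z i (zeta k) i0 (hzeta k) _ (dzeta k).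
  exists v => //; exists w => // L; apply/eqP; rewrite -subr_eq0; apply/eqP.
  exact: dw.
have {Pv}/choice[w Pw] : forall k, exists w, khom i.+1 w /\
    forall L, v * ktrans a (N - n) (zeta k) L = kdiff (apow a n) w L.
  by move=> k; have [w hw dw] := Pv k; exists w.
exists (tau (v * u%:MP)), (fun L => \sum_k (b k)%:MP * tau (w k L)); split.
- by exists (v * u%:MP) => //; apply: UM.
- by move=> L Li; apply: big1 => k _; rewrite (proj1 (Pw k)) // rmorph0 mulr0.
- by move=> L; apply: ideal_sum => // k _; apply: coeffwise_constM.
move=> L; rewrite sum_kdiff.
have -> : \sum_k (b k)%:MP * tau (kdiff (apow a n) (w k) L) =
    tau v * ktrans (tau \o a) (N - n)
      (fun L => \sum_k (b k)%:MP * tau (zeta k L)) L.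
  rewrite {1}/ktrans mulr_sumr mulr_sumr; apply: eq_bigr => k _.
  rewrite -(proj2 (Pw k) L) rmorphM.
  have <- := ktrans_morph tau a (N - n) (zeta k) L.
  rewrite /ktrans [(tau \o zeta k) L]/(tau (zeta k L)).
  by rewrite [LHS]mulrCA [X in _ = _ * X]mulrCA.
rewrite (rmorphM tau) -ktrans_affine.
apply: (idealM idcG); exact: (ktrans_ideal _ _ idcG).
Qed.

End Flat.

(** * Bound on flat dimension by Hilbert's syzygies *)

Section Syzygy.
Variables (S : idomainType) (d : nat).
Local Notation A := {mpoly S[d]}.
Local Notation D := {mpoly {mpoly S[d]}[d]}.
Local Notation tau := (@tau S d).

Variable U : A -> Prop.
Hypothesis U1 : U 1.
Hypothesis UM : forall u v, U u -> U v -> U (u * v).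
Hypothesis U0 : ~ U 0.

Lemma tau_set1 : tau_set U 1.
Proof. by exists 1 => //; rewrite rmorph1. Qed.

Lemma tau_setM u v : tau_set U u -> tau_set U v -> tau_set U (u * v).
Proof.
move=> [x Ux ->] [y Uy ->]; exists (x * y); first exact: UM.
by rewrite rmorphM.
Qed.

(** Modulo these elements both copies of A in D are identified, and D becomes
    A. *)
Definition diag (i : 'I_d) : D := 'X_i - ('X_i)%:MP.

Definition diag_eval : D -> A := mmap idfun (fun i => 'X_i).
HB.instance Definition _ := GRing.RMorphism.on diag_eval.

Lemma diag_evalC c : diag_eval c%:MP = c. Proof. exact: mmapC. Qed.
Lemma diag_evalX i : diag_eval 'X_i = 'X_i.
Proof. by rewrite [LHS]mmapX mmap1U. Qed.

Lemma diag_eval_tau x : diag_eval (tau x) = x.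
Proof.
apply: (mpoly_morph_ext (f := diag_eval \o tau) (g := idfun)) => [c|i] /=.
  by rewrite /tau map_mpolyC diag_evalC.
by rewrite /tau map_mpolyX diag_evalX.
Qed.

Definition consts (J : A -> Prop) (w : D) : Prop := exists2 c, J c & w = c%:MP.

(** Written as an ideal with constant generators, J[Y] fits the regularity
    criterion for polynomials in the variables Y. *)
Lemma coeffwise_gen (J : A -> Prop) : ideal J ->
  seq_ideal diag (consts J) 0 = coeffwise J.
Proof.
move=> idJ; apply/funext => w; apply/propext; split.
  apply: gen_min; first exact: coeffwise_ideal.
  move=> h [[c Jc ->] m|[j]]; last by rewrite ltn0.
  by rewrite mcoeffC; apply: ideal_mulr.
move=> Jw; rewrite [w]mpolyE.
apply: ideal_sum => [|m _]; first exact: gen_ideal.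
rewrite -mul_mpolyC; apply: ideal_mulr; first exact: gen_ideal.
by apply: gen_in; left; exists w@_m.
Qed.

Lemma split_var_diag i j :
  split_var i (diag j) = split_var_X _ i j - ('X_j)%:MP%:P.
Proof. by rewrite /diag split_varB split_varX split_varC. Qed.

(** Y_i - X_i is monic in Y_i, and the generators of the ideal do not involve
    Y_i. *)
Lemma diag_reg (J : A -> Prop) (i : 'I_d) :
  reg_mod (tau_set U) (seq_ideal diag (consts J) i) (diag i).
Proof.
apply: (@reg_mod_lead _ d i _ tau_set1 tau_setM) => [h [[c _ ->]|[j ji ->]]|].
- exact: split_varC.
- rewrite split_var_diag /split_var_X.
  have -> : (j == i) = false by apply: contraTF ji => /eqP ->; rewrite ltnn.
  by rewrite -polyCB.
by rewrite split_var_diag /split_var_X eqxx lead_coefXsubC; apply: tau_set1.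
Qed.

Lemma diag_congr (J : A -> Prop) x :
  seq_ideal diag (consts J) d (tau x - x%:MP).
Proof.
set I := seq_ideal _ _ _; have idI : ideal I by exact: gen_ideal.
pose good (w : D) := I (w - (diag_eval w)%:MP).
suff : good (tau x) by rewrite /good diag_eval_tau.
apply: (mpoly_closed_ind (P := good)) => [c|i|v w|v w]; rewrite /good.
- by rewrite diag_evalC subrr; apply: (ideal0 idI).
- by rewrite diag_evalX; apply: gen_in; right; exists i.
- by rewrite rmorphD mpolyCD opprD addrACA; apply: (idealD idI).
rewrite rmorphM mpolyCM => Iv Iw.
have -> : v * w - (diag_eval v)%:MP * (diag_eval w)%:MP =
  w * (v - (diag_eval v)%:MP) + (diag_eval v)%:MP * (w - (diag_eval w)%:MP).
  by ring.
by apply: (idealD idI); apply: (idealM idI).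
Qed.

Lemma diag_eval_ideal (J : A -> Prop) w : ideal J ->
  seq_ideal diag (consts J) d w -> J (diag_eval w).
Proof.
move=> idJ; apply: (gen_min (I := fun w => J (diag_eval w))).
  split=> [|x y Jx Jy|r x Jx]; first by rewrite rmorph0; apply: ideal0.
    by rewrite rmorphD; apply: idealD.
  by rewrite rmorphM; apply: idealM.
move=> h [[c Jc hE]|[i _ hE]]; rewrite hE; first by rewrite diag_evalC.
by rewrite rmorphB /= diag_evalX diag_evalC subrr; apply: ideal0.
Qed.

(** t bounds the flat dimension of the modules over the local ring of the base,
    which is a valuation ring or a field. *)
Definition base_dim (t : nat) : Prop :=
  (t = 1%N /\ locally_val (const_set U)) \/
  (t = 0%N /\ forall u, u != 0 -> const_set U u).

Variables (l : nat) (a : 'I_l -> A) (nu : nat -> nat) (t : nat).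
Hypothesis a_wpr : pro_acyclic a U nu.
Hypothesis base : base_dim t.

Lemma coeffwise_unit : coeffwise (@unit_ideal A) = @unit_ideal D.
Proof. by apply/funext => w; apply/propext. Qed.

(** Over a valuation ring use 0 -> J -> A -> A/J -> 0, with torsion-free J and
    A; over a field A/J itself is flat. *)
Lemma base_pro_zero : exists mu, forall n, (0 < n)%N -> (n <= mu n)%N /\
  forall J, ideal J -> pro_zero (tau \o a) (tau_set U) n (mu n) t
    (coeffwise J) (@unit_ideal D).
Proof.
case: base => -[-> bt]; last first.
  exists nu => n n0; have [le_n Z] := a_wpr n0; split=> // J idJ.
  rewrite -coeffwise_unit; apply: flat_extension => //.
  exact: reducible_field.
exists (fun n => nu (nu n)) => n n0; have [le_n Z] := a_wpr n0.
have [le_m Z'] := a_wpr (leq_trans n0 le_n).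
split=> [|J idJ]; first exact: leq_trans le_m.
have idz := @ideal_zero A.
have red G' : reducible_relations U (@zero_ideal A) G'.
  exact: reducible_torsion_free.
rewrite -coeffwise_unit.
apply: (@pro_zero_ses _ _ _ _ tau_setM _ (nu n) _ _ (coeffwise (@zero_ideal A))).
- by rewrite le_n.
- exact: coeffwise_ideal.
- exact: coeffwise_ideal.
- exact: coeffwise_ideal.
- by move=> x x0 m; rewrite (x0 m); apply: ideal0.
- by [].
- by apply: flat_extension => // x ->; apply: ideal0.
- apply: (pro_zeroW (leq0n 1)).
  by apply: (flat_extension U1 UM (ideal_zero A) (ideal_unit A) _ (red _) Z).
Qed.

(** With J generated by the a_i^N, the element 1 of A/J is a cycle of top degree
    l > t + d.  There are no boundaries in top degree, so its image under the
    transition, the product of the a_i^(N - n), is zero up to U. *)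
Theorem weak_dim_vanishing : (t + d < l)%N -> kills_top a U.
Proof.
move=> tdl n n0; have [mu Zmu] := base_pro_zero.
pose N := iter (2 ^ d) mu n.
have chain J : ideal J -> (n <= N)%N /\
    pro_zero (tau \o a) (tau_set U) n N (t + d)
      (seq_ideal diag (consts J) d) (@unit_ideal D).
  move=> idJ; apply: pro_zero_chain => //.
  - exact: tau_set1.
  - exact: tau_setM.
  - by move=> i _; apply: diag_reg.
  - move=> k k0; have [le_k Z] := Zmu k k0; split=> //.
    by rewrite coeffwise_gen //; apply: Z.
pose J := gen (initial (apow a N) l); have idJ : ideal J by apply: gen_ideal.
have [le_nN Z] := chain J idJ; set I := seq_ideal _ _ _ in Z.
have idI : ideal I by apply: gen_ideal.
pose z (L : {set 'I_l}) : D := if L == setT then 1 else 0.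
have [||L|_ [w [[u Uu ->] hw _ dw]]] := Z l z tdl.
- move=> L Ll; rewrite /z; case: eqP => // LT.
  by rewrite LT cardsT card_ord eqxx in Ll.
- by [].
- apply: ideal_sum => // j _; apply: (ideal_mulr idI); apply: (idealM idI).
  have -> : apow (tau \o a) N j =
      (tau (a j ^+ N) - (a j ^+ N)%:MP) + (a j ^+ N)%:MP.
    by rewrite subrK /apow rmorphXn.
  apply: (idealD idI); first exact: diag_congr.
  apply: gen_in; left; exists (a j ^+ N) => //.
  by apply: gen_in; exists j.
exists N, u; split=> //.
have := diag_eval_ideal idJ (dw setT).
have -> : kdiff (apow (tau \o a) n) w setT = 0 by apply: big1 => j; rewrite inE.
rewrite subr0 (rmorphM diag_eval) /= diag_eval_tau /ktrans /z eqxx mulr1.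
rewrite (rmorph_prod diag_eval).
rewrite (eq_bigr (fun k => a k ^+ (N - n))) => [|k _]; last first.
  by rewrite /= -rmorphXn diag_eval_tau.
by rewrite (eq_bigl xpredT) ?prodrXl // => k; rewrite inE.
Qed.

End Syzygy.

(** * Bound on depth *)

Section Depth.
Variables (D : comNzRingType) (U : D -> Prop).
Hypothesis U1 : U 1.
Hypothesis UM : forall u v, U u -> U v -> U (u * v).

(** The Koszul homology of y^k on D / (a_0, ..., a_(s-1)) vanishes above degree
    s, since that of D vanishes above degree 0 and each quotient costs one
    degree.  If s < t, this applies to degree t, where the homology consists of
    the elements killed by the y_j^k; a multiple of x is one of these. *)
Theorem depth_le (t l s : nat) (y : 'I_t -> D) (a : 'I_l -> D) (x : D) :
  (forall k, reg_seq U (apow y k)) -> (s <= l)%N ->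
  (forall i : 'I_l, (i < s)%N -> reg_mod U (gen (initial a i)) (a i)) ->
  (forall j, exists k u, U u /\ gen (initial a s) (u * (y j ^+ k * x))) ->
  (forall u, U u -> ~ gen (initial a s) (u * x)) ->
  (t <= s)%N.
Proof.
move=> y_reg sl a_reg yx xnz; rewrite leqNgt; apply/negP => st.
set I := gen (initial a s) in yx xnz; have idI : ideal I by apply: gen_ideal.
(* One exponent for all y_j, positive because pro_zero_chain requires it. *)
have [k0 yk0] := choice yx; pose k := (\max_j k0 j).+1.
have [|j|u Uu yu] := common_mult U1 UM (P := fun j u => I (u * (y j ^+ k * x))).
- by move=> j u v Iu; rewrite -mulrA; apply: idealM.
- have [u [Uu Iu]] := yk0 j; exists u => //.
  have lek : (k0 j <= k)%N by apply: leqW; apply: leq_bigmax.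
  by rewrite -(subnK lek) exprD -!mulrA mulrCA; apply: idealM.
have Z : pro_zero y U k k s I (@unit_ideal D).
  have idk m : iter m id k = k by elim: m.
  have reg0 (i : 'I_l) : (i < s)%N ->
    reg_mod U (seq_ideal a (@zero_ideal D) i) (a i).
    by rewrite seq_ideal_zero; apply: a_reg.
  have Z0 n : (0 < n)%N -> (n <= id n)%N /\
    pro_zero y U n (id n) 0 (seq_ideal a (@zero_ideal D) 0) (@unit_ideal D).
    split=> //; rewrite seq_ideal0; last exact: ideal_zero.
    exact: reg_seq_pro_zero.
  have [_] := pro_zero_chain U1 UM sl reg0 Z0 (ltn0Sn _ : (0 < k)%N).
  by rewrite seq_ideal_zero add0n idk.
pose z (L : {set 'I_t}) : D := if L == setT then u * x else 0.
have [||L|v [w [Uv hw _ dw]]] := Z t z st.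
- move=> L Ll; rewrite /z; case: eqP => // LT.
  by rewrite LT cardsT card_ord eqxx in Ll.
- by [].
- apply: ideal_sum => // j _; rewrite /z; case: eqP => _; last first.
    by rewrite mulr0; apply: ideal0.
  by rewrite -mulrA; apply: idealM => //; rewrite mulrCA; exact: yu.
have := dw setT.
have -> : kdiff (apow y k) w setT = 0 by apply: big1 => j; rewrite inE.
by rewrite subnn ktrans0 /z eqxx subr0 mulrA; apply: xnz; apply: UM.
Qed.

End Depth.

Section Fibre.
Variables (S : idomainType) (d : nat).
Local Notation A := {mpoly S[d]}.

Definition poly_in_var (i : 'I_d) (g : {poly S}) : A :=
  (map_poly (@mpolyC d S) g).['X_i].

Lemma split_var_poly_in_var i j g : split_var i (poly_in_var j g) =
  if j == i then map_poly (@mpolyC d S) g else (poly_in_var j g)%:P.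
Proof.
rewrite /poly_in_var -horner_map /= split_varX /split_var_X -map_poly_comp.
rewrite (@eq_map_poly _ _ _ (polyC \o @mpolyC d S)); last first.
  by move=> c; rewrite /= split_varC.
rewrite map_poly_comp; case: eqP => _.
  exact: comp_polyXr.
by rewrite horner_map.
Qed.

Variable U : A -> Prop.
Hypothesis U1 : U 1.
Hypothesis UM : forall u v, U u -> U v -> U (u * v).
Hypothesis U0 : ~ U 0.

Lemma poly_in_var_reg (g : {poly S}) i k (H : A -> Prop) :
  U (lead_coef g)%:MP ->
  (forall h, H h -> split_var i h = h%:P) ->
  reg_mod U (gen H) (poly_in_var i g ^+ k).
Proof.
move=> Ug HC; apply: (reg_mod_lead (i := i)) => //.
rewrite rmorphXn /= split_var_poly_in_var eqxx lead_coef_exp.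
rewrite lead_coef_map_inj; last first.
- by rewrite mpolyC0.
- exact: (can_inj (@mpolyCK _ _)).
by elim: k => [|k IH]; rewrite ?expr0 // exprS; apply: UM.
Qed.

Variable g : 'I_d -> {poly S}.
Hypothesis g_lead : forall i, U (lead_coef (g i))%:MP.

Lemma fibre_reg k : reg_seq U (apow (fun i => poly_in_var i (g i)) k).
Proof.
move=> i; apply: poly_in_var_reg => // h [j ji ->].
rewrite rmorphXn /= split_var_poly_in_var.
have -> : (j == i) = false by apply: contraTF ji => /eqP ->; rewrite ltnn.
by rewrite rmorphXn.
Qed.

(** The constant comes first, so that each later member is a polynomial in a
    variable that does not occur in the previous ones. *)
Definition with_const (c : S) (i : 'I_d.+1) : A :=
  if unlift ord0 i is Some j then poly_in_var j (g j) else c%:MP.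

Lemma with_const_reg c k : c != 0 -> reg_seq U (apow (with_const c) k).
Proof.
move=> c0 i; case: (unliftP ord0 i) => [j|] ->.
  rewrite {2}/apow /with_const liftK; apply: poly_in_var_reg => // h [i' ji ->].
  rewrite /apow /with_const; case: (unliftP ord0 i') ji => [j' ->|_ _].
    rewrite !lift0 ltnS => ji; rewrite rmorphXn /= split_var_poly_in_var.
    have -> : (j' == j) = false by apply: contraTF ji => /eqP ->; rewrite ltnn.
    by rewrite rmorphXn.
  by rewrite !rmorphXn /= split_varC.
move=> w /initial0/eqP; rewrite /apow /with_const unlift_none mulf_eq0.
rewrite expf_eq0 mpolyC_eq0 (negPf c0) andbF => /eqP ->.
by exists 1 => //; rewrite mulr0; apply: gen_zero.
Qed.

End Fibre.

(** Both bounds together, for a valuation ring S and variables algebraic over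
    the residue field.  The regular sequence in the prime complementary to U has
    length d, or d + 1 if this prime contains a nonzero constant. *)
Theorem top_vanishing (S : idomainType) (d l : nat)
    (U : {mpoly S[d]} -> Prop) (a : 'I_l.+1 -> {mpoly S[d]})
    (x : {mpoly S[d]}) (nu : nat -> nat) :
  mult_set U -> ~ U 0 -> locally_val (const_set U) ->
  (forall i, exists2 g, U (lead_coef g)%:MP & ~ U (poly_in_var i g)) ->
  pro_acyclic a U nu ->
  (forall i : 'I_l.+1, (i < l)%N -> reg_mod U (gen (initial a i)) (a i)) ->
  (forall b, ~ U b ->
     exists k u, U u /\ gen (initial a l) (u * (b ^+ k * x))) ->
  (forall u, U u -> ~ gen (initial a l) (u * x)) ->
  kills_top a U.
Proof.
move=> [U1 UM] U0 val alg wpr a_reg assoc xnz.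
have /choice[g Pg] : forall i, exists g : {poly S},
    U (lead_coef g)%:MP /\ ~ U (poly_in_var i g).
  by move=> i; have [h] := alg i; exists h.
have g_lead i := proj1 (Pg i).
suff [t [bt tdl]] : exists t, base_dim U t /\ (t + d <= l)%N.
  by apply: (weak_dim_vanishing U1 UM U0 wpr bt); rewrite ltnS.
have [[c [c0 Uc]]|fld] := pselect (exists c : S, c != 0 /\ ~ U c%:MP).
  exists 1%N; split; first by left.
  apply: (depth_le U1 UM (y := with_const g c) _ (leqnSn l) a_reg _ xnz).
    by move=> k; apply: with_const_reg.
  move=> j; apply: assoc; rewrite /with_const; case: unlift => // i.
  exact: (proj2 (Pg i)).
exists 0%N; split.
  right; split=> // c c0; apply: contrapT => Uc; apply: fld.
  by exists c.
pose y i := poly_in_var i (g i).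
apply: (depth_le U1 UM (y := y) _ (leqnSn l) a_reg _ xnz).
  by move=> k; apply: fibre_reg.
by move=> j; apply: assoc; apply: (proj2 (Pg j)).
Qed.

(** * Transfer between a ring and its localizations *)

Record prime_complement (B : comNzRingType) (W : B -> Prop) : Prop := {
  pc_mult : mult_set W;
  pc_0 : ~ W 0;
  pc_add : forall x y, W (x + y) -> W x \/ W y;
  pc_mul : forall x y, W (x * y) -> W y }.

Section Transfer.
Variables (A : idomainType) (B : comNzRingType) (j : {rmorphism A -> B}).

Definition inverted (s : A) : Prop := exists v, j s * v = 1.

Definition localization_map : Prop :=
  injective j /\ forall b, exists s a, inverted s /\ j s * b = j a.

Hypothesis j_loc : localization_map.

Lemma inverted1 : inverted 1.
Proof. by exists 1; rewrite rmorph1 mulr1. Qed.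

Lemma invertedM s t : inverted s -> inverted t -> inverted (s * t).
Proof.
by move=> [v sv] [w tw]; exists (v * w); rewrite rmorphM mulrACA sv tw mulr1.
Qed.

Lemma invertedX s n : inverted s -> inverted (s ^+ n).
Proof.
move=> Is; elim: n => [|n IH]; first by rewrite expr0; apply: inverted1.
by rewrite exprS; apply: invertedM.
Qed.

Lemma inverted_reg s b : inverted s -> j s * b = 0 -> b = 0.
Proof. by move=> [v sv] sb; rewrite -[b]mul1r -sv mulrAC sb mul0r. Qed.

Lemma common_denominator (J : finType) (b : J -> B) :
  exists s (a : J -> A), inverted s /\ forall i, j s * b i = j (a i).
Proof.
have [|i|s Is Ps] := common_mult inverted1 invertedM
    (P := fun i s => exists a, j s * b i = j a).
- by move=> i s t [a sa]; exists (t * a); rewrite !rmorphM -sa mulrA.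
- by have [s [a [Is sa]]] := proj2 j_loc (b i); exists s => //; exists a.
by have /choice[a Pa] := Ps; exists s, a.
Qed.

Lemma gen_image (l i : nat) (a : 'I_l -> B) (al : 'I_l -> A) c x :
  (forall k, j (al k) = c * a k) ->
  gen (initial al i) x -> gen (initial a i) (j x).
Proof.
move=> alE; apply: (gen_min (I := fun x => gen (initial a i) (j x))).
  split=> [|y z Hy Hz|r y Hy]; rewrite ?rmorph0 ?rmorphD ?rmorphM.
  - exact: gen_zero.
  - by apply: idealD => //; apply: gen_ideal.
  - by apply: idealM => //; apply: gen_ideal.
move=> h [k ki ->]; rewrite alE; apply: idealM; first exact: gen_ideal.
by apply: gen_in; exists k.
Qed.

Lemma gen_preimage (l i : nat) (a : 'I_l -> B) (al : 'I_l -> A) s x :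
  inverted s -> (forall k, j (al k) = j s * a k) ->
  gen (initial a i) (j x) -> exists2 u, inverted u & gen (initial al i) (u * x).
Proof.
move=> Is alE /initialP[b b0 xE].
have [t [c [It cE]]] := common_denominator b.
exists (t * s); first exact: invertedM.
have -> : t * s * x = \sum_k c k * al k.
  apply: (proj1 j_loc); rewrite !rmorphM xE mulr_sumr rmorph_sum.
  by apply: eq_bigr => k _; rewrite rmorphM -cE alE; ring.
apply: ideal_sum => [|k _]; first exact: gen_ideal.
have [ki|ik] := ltnP k i.
  apply: idealM; first exact: gen_ideal.
  by apply: gen_in; exists k.
have -> : c k = 0 by apply: (proj1 j_loc); rewrite -cE b0 // mulr0 rmorph0.
by rewrite mul0r; apply: gen_zero.
Qed.

Lemma kdiff_scale (D : comNzRingType) (l : nat) c (b b' : 'I_l -> D) z L :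
  (forall k, b' k = c * b k) -> kdiff b' z L = c * kdiff b z L.
Proof.
move=> bE; rewrite /kdiff mulr_sumr; apply: eq_bigr => k _.
by rewrite bE; ring.
Qed.

Lemma ktrans_scale (D : comNzRingType) (l : nat) c (b b' : 'I_l -> D) i m z L :
  (forall k, b' k = c * b k) -> khom i z ->
  ktrans b' m z L = c ^+ (m * i) * ktrans b m z L.
Proof.
move=> bE hz; rewrite /ktrans; have [Li|Li] := eqVneq #|L| i; last first.
  by rewrite hz // !mulr0.
rewrite (eq_bigr (fun k => c ^+ m * b k ^+ m)) => [|k _]; last first.
  by rewrite bE exprMn.
by rewrite big_split /= prodr_const Li exprM mulrA.
Qed.

(** If al = s a with s a unit, the differentials for al^n and a^n differ by the
    factor s^n, and the transition maps in degree i by s^((N-n)i); the remaining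
    step is to clear the denominators of the chain that bounds. *)
Lemma pro_zero_transfer (l n N : nat) (a : 'I_l -> B) (al : 'I_l -> A) s
    (U : A -> Prop) :
  inverted s -> (forall k, j (al k) = j s * a k) ->
  (forall u, inverted u -> U u) ->
  pro_zero a (fun u => u = 1) n N 0 (@zero_ideal B) (@unit_ideal B) ->
  pro_zero al U n N 0 (@zero_ideal A) (@unit_ideal A).
Proof.
move=> Is alE UI Z i z i0 hz _ dz.
have apowE e k : apow (j \o al) e k = j s ^+ e * apow a e k.
  by rewrite /apow /= alE exprMn.
have hjz : khom i (j \o z) by move=> L Li; rewrite /= hz // rmorph0.
have [//|L|_ [w [-> hw _ dw]]] := Z i (j \o z) i0 hjz.
  apply: (@inverted_reg (s ^+ N)); first exact: invertedX.
  by rewrite rmorphXn -(kdiff_scale _ _ (apowE N)) kdiff_morph dz rmorph0.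
have [t [w' [It w'E]]] := common_denominator w.
exists (s ^+ n * t), (fun L => s ^+ ((N - n) * i) * w' L); split.
- by apply: UI; apply: invertedM => //; apply: invertedX.
- move=> L Li; apply: (proj1 j_loc).
  by rewrite rmorphM -w'E hw // !mulr0 rmorph0.
- by [].
move=> L; apply: (proj1 j_loc); rewrite rmorph0 kdiffZ.
have := kdiff_morph j al n w' L; have := ktrans_morph j al (N - n) z L.
move: (ktrans al _ z L) (kdiff (apow al n) w' L) => X Y XE YE.
rewrite rmorphB !rmorphM -XE -YE !rmorphXn.
rewrite (ktrans_scale (c := j s) (b := a) _ _ _ hjz); last first.
  by move=> k; rewrite /= alE.
rewrite (kdiff_scale _ _ (apowE n)).
have -> : kdiff (apow a n) (j \o w') L = j t * ktrans a (N - n) (j \o z) L.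
  have := dw L; rewrite mul1r => /eqP; rewrite subr_eq0 => /eqP ->.
  by rewrite -kdiffZ; apply: eq_bigr => k _; rewrite /= -w'E.
by rewrite [X in X - _]mulrACA; ring.
Qed.

End Transfer.

(** Multiplied by a common denominator, the sequence a comes from the polynomial
    ring, where top_vanishing applies. *)
Theorem top_vanishing_loc (S : idomainType) (d l : nat) (B : comNzRingType)
    (j : {rmorphism {mpoly S[d]} -> B}) (W : B -> Prop)
    (a : 'I_l.+1 -> B) (x : B) (nu : nat -> nat) :
  localization_map j -> prime_complement W ->
  locally_val (fun s => W (j s%:MP)) ->
  (forall i, exists2 g, W (j (lead_coef g)%:MP) & ~ W (j (poly_in_var i g))) ->
  pro_acyclic a (fun u => u = 1) nu ->
  (forall (i : 'I_l.+1) b, (i < l)%N ->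
     gen (initial a i) (a i * b) -> gen (initial a i) b) ->
  (forall b, ~ W b ->
     exists k u, W u /\ gen (initial a l) (u * (b ^+ k * x))) ->
  (forall u, W u -> ~ gen (initial a l) (u * x)) ->
  kills_top a W.
Proof.
move=> jl [[W1 WM] W0 WD WMr] val alg wpr a_reg assoc xnz.
pose U y := W (j y).
have UI u : inverted j u -> U u.
  by move=> [v uv]; apply: (WMr v); rewrite mulrC uv.
have [s [al [Is alE0]]] := common_denominator jl a.
have alE k : j (al k) = j s * a k by rewrite alE0.
have [t [x' [It x'E]]] : exists t x', inverted j t /\ j t * x = j x'.
  by have := proj2 jl x.
have reg (i : 'I_l.+1) : (i < l)%N -> reg_mod U (gen (initial al i)) (al i).
  move=> il w /(gen_image alE); rewrite rmorphM alE => H.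
  have [v sv] := Is; have {}H : gen (initial a i) (a i * j w).
    have -> : a i * j w = v * (j s * a i * j w).
      by rewrite -[LHS]mul1r -sv; ring.
    by apply: idealM => //; apply: gen_ideal.
  have [u Iu Hu] := gen_preimage jl Is alE (a_reg i _ il H).
  by exists u => //; apply: UI.
have van : kills_top al U.
  apply: (top_vanishing (U := U) (x := x') (nu := nu)) => //.
  - split; first by rewrite /U rmorph1.
    by move=> u v; rewrite /U rmorphM; apply: (WM).
  - by rewrite /U rmorph0.
  - move=> m m0; have [le_m Z] := wpr m m0; split=> //.
    exact: (pro_zero_transfer jl Is alE UI).
  - move=> b /assoc[k [w [Ww Hw]]].
    have [r [w' [Ir w'E]]] := proj2 jl w.
    have [|u Iu Hu] :=
        gen_preimage (i := l) (x := w' * (b ^+ k * x')) jl Is alE.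
      rewrite !rmorphM rmorphXn -w'E -x'E.
      have -> : j r * w * (j b ^+ k * (j t * x)) =
          j r * j t * (w * (j b ^+ k * x)).
        by ring.
      by apply: idealM => //; apply: gen_ideal.
    exists k, (u * w'); split; last by rewrite -mulrA.
    rewrite /U rmorphM; apply: (WM); first exact: UI.
    by rewrite -w'E; apply: (WM) => //; apply: UI.
  - move=> u Uu Hu; have [v tv] := It; apply: (xnz (j u)) => //.
    have -> : j u * x = v * j (u * x').
      by rewrite rmorphM -x'E -[LHS]mul1r -tv; ring.
    apply: idealM; first exact: gen_ideal.
    exact: gen_image Hu.
move=> n /van[N [u [nN Uu Hu]]].
(* The product of the al_i is that of the a_i times s^(l+1). *)
have [v sv] := invertedX (l.+1 * (N - n)) Is.
exists N, (j u); split=> //.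
have powE k : j (apow al N k) = j s ^+ N * apow a N k.
  by rewrite rmorphXn alE exprMn.
have := gen_image powE Hu; rewrite rmorphM rmorphXn rmorph_prod.
rewrite (eq_bigr (fun k => j s * a k)) => [|k _]; last exact: alE.
rewrite big_split /= prodr_const card_ord exprMn -exprM -rmorphXn => H.
have -> : j u * (\prod_k a k) ^+ (N - n) =
    v * (j u * (j (s ^+ (l.+1 * (N - n))) * (\prod_k a k) ^+ (N - n))).
  by rewrite -[LHS]mul1r -sv; ring.
by apply: idealM => //; apply: gen_ideal.
Qed.

(** * Transcendental variables as part of the base ring *)

Section BaseChange.
Variables (S : idomainType) (d : nat) (i0 : 'I_d.+1).
Local Notation A := {mpoly S[d.+1]}.
Local Notation A' := {mpoly {poly S}[d]}.

HB.instance Definition _ :=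
  GRing.RMorphism.copy (@poly_in_var S d.+1 i0)
    (horner_eval 'X_i0 \o map_poly (@mpolyC d.+1 S)).

Lemma poly_in_varC c : poly_in_var i0 c%:P = c%:MP :> A.
Proof. by rewrite /poly_in_var map_polyC hornerC. Qed.

Lemma poly_in_varX : poly_in_var i0 'X = 'X_i0 :> A.
Proof. by rewrite /poly_in_var map_polyX hornerX. Qed.

(** The isomorphism of S[x][X_1, ..., X_d] with the polynomial ring in d + 1
    variables that sends x to the variable of index i0. *)
Definition unmerge : A' -> A :=
  mmap (@poly_in_var S d.+1 i0) (fun k => 'X_(lift i0 k)).
HB.instance Definition _ := GRing.RMorphism.on unmerge.

Lemma unmergeC g : unmerge g%:MP = poly_in_var i0 g. Proof. exact: mmapC. Qed.
Lemma unmergeX k : unmerge 'X_k = 'X_(lift i0 k).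
Proof. by rewrite [LHS]mmapX mmap1U. Qed.

Definition merge_X (k : 'I_d.+1) : A' :=
  if unlift i0 k is Some k' then 'X_k' else 'X%:MP.

Definition merge : A -> A' := mmap (@mpolyC d {poly S} \o polyC) merge_X.
HB.instance Definition _ := GRing.RMorphism.on merge.

Lemma mergeC c : merge c%:MP = c%:P%:MP. Proof. exact: mmapC. Qed.
Lemma mergeX k : merge 'X_k = merge_X k.
Proof. by rewrite [LHS]mmapX mmap1U. Qed.

Lemma mergeK : cancel merge unmerge.
Proof.
apply: (mpoly_morph_ext (f := unmerge \o merge) (g := idfun)) => [c|k] /=.
  by rewrite mergeC unmergeC poly_in_varC.
rewrite mergeX /merge_X; case: unliftP => [k'|] ->.
  exact: unmergeX.
by rewrite unmergeC poly_in_varX.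
Qed.

Lemma unmergeK : cancel unmerge merge.
Proof.
apply: (mpoly_morph_ext (f := merge \o unmerge) (g := idfun)) => [g|k] /=.
  rewrite unmergeC /poly_in_var -horner_map /= mergeX /merge_X unlift_none.
  rewrite -map_poly_comp.
  rewrite (@eq_map_poly _ _ _ (@mpolyC d {poly S} \o polyC)); last first.
    by move=> c; rewrite /= mergeC.
  rewrite map_poly_comp horner_map; congr _%:MP.
  exact: comp_polyXr.
by rewrite unmergeX mergeX /merge_X liftK.
Qed.

Lemma localization_map_unmerge (B : comNzRingType) (j : {rmorphism A -> B}) :
  localization_map j -> localization_map (j \o unmerge).
Proof.
move=> [j_inj j_frac]; split.
  exact: inj_comp j_inj (can_inj unmergeK).
move=> b; have [s [a [[v sv] sb]]] := j_frac b.
exists (merge s), (merge a); rewrite /= !mergeK; split=> //.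
by exists v; rewrite /= mergeK.
Qed.

End BaseChange.

(** Dividing by a coefficient that divides all others leaves a polynomial with
    an invertible coefficient. *)
Lemma poly_content (S : idomainType) (V : S -> Prop) (f : {poly S}) :
  mult_set V -> ~ V 0 -> locally_val V -> f != 0 ->
  exists u c f0, [/\ V u, u *: f = c *: f0 & exists k, V f0`_k].
Proof.
move=> VM V0 val f0; have sf : (0 < size f)%N by rewrite size_poly_gt0.
have [k [u [h [Vu hk]]]] :=
  locally_val_min (fun i : 'I_(size f).-1.+1 => f`_i) VM val.
pose g := \poly_(i < (size f).-1.+1) (if insub i is Some i' then h i' else 0).
have gE (i : 'I_(size f).-1.+1) : g`_i = h i.
  by rewrite coef_poly ltn_ord valK.
have ufE : u *: f = f`_k *: g.
  apply/polyP => i; rewrite !coefZ.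
  have [lt_i|le_i] := ltnP i (size f).-1.+1.
    by rewrite (hk (Ordinal lt_i)) -gE mulrC.
  rewrite coef_poly ltnNge le_i mulr0 nth_default ?mulr0 //.
  by rewrite -(prednK sf).
exists u, f`_k, g; split=> //; exists k.
suff -> : g`_k = u by [].
have u0 : u != 0 by apply: contra_notN V0 => /eqP <-.
have fk : f`_k != 0.
  apply: contraNneq f0 => fk; have /eqP := ufE.
  by rewrite fk scale0r -mul_polyC mulf_eq0 polyC_eq0 (negPf u0).
by apply: (mulIf fk); rewrite gE -hk.
Qed.

(** Gauss extension of a valuation: of two polynomials, the one whose content
    divides the other content divides the other polynomial, because polynomials
    with an invertible coefficient are invertible. *)
Lemma locally_val_poly (S : idomainType) (V : S -> Prop)
    (V' : {poly S} -> Prop) :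
  mult_set V -> ~ V 0 -> locally_val V -> mult_set V' ->
  (forall (g : {poly S}) k, V g`_k -> V' g) -> locally_val V'.
Proof.
move=> VM V0 val [V'1 V'M] VV' f g.
have V'C u : V u -> V' u%:P.
  by move=> Vu; apply: (VV' _ 0%N); rewrite coefC eqxx.
have [->|f0] := eqVneq f 0.
  by exists 1, 0; split=> //; left; rewrite mulr0 mul0r.
have [->|g0] := eqVneq g 0.
  by exists 1, 0; split=> //; right; rewrite mulr0 mul0r.
have [u [c [p [Vu ufE [k Vp]]]]] := poly_content VM V0 val f0.
have [v [e [q [Vv vgE [k' Vq]]]]] := poly_content VM V0 val g0.
have [w [h [Vw wE]]] := val c e.
have V'p := VV' _ _ Vp; have V'q := VV' _ _ Vq.
rewrite -!mul_polyC in ufE vgE.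
case: wE => wE; have {}wE := congr1 (fun z => z%:P) wE;
  rewrite !rmorphM /= in wE.
  exists (w%:P * u%:P * q), (h%:P * v%:P * p); split; last left.
    by do 2 apply: (V'M) => //; apply: V'C.
  have -> : w%:P * u%:P * q * f = (w%:P * c%:P) * p * q.
    transitivity (w%:P * q * (u%:P * f)); [ring | rewrite ufE; ring].
  have -> : h%:P * v%:P * p * g = (h%:P * e%:P) * p * q.
    transitivity (h%:P * p * (v%:P * g)); [ring | rewrite vgE; ring].
  by rewrite wE.
exists (w%:P * v%:P * p), (h%:P * u%:P * q); split; last right.
  by do 2 apply: (V'M) => //; apply: V'C.
have -> : w%:P * v%:P * p * g = (w%:P * e%:P) * p * q.
  transitivity (w%:P * p * (v%:P * g)); [ring | rewrite vgE; ring].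
have -> : h%:P * u%:P * q * f = (h%:P * c%:P) * p * q.
  transitivity (h%:P * q * (u%:P * f)); [ring | rewrite ufE; ring].
by rewrite wE.
Qed.

Section LeadingToAny.
Variables (S : idomainType) (B : comNzRingType) (W : B -> Prop).
Variable f : {rmorphism {poly S} -> B}.
Hypothesis WP : prime_complement W.

(** Terms with coefficient outside W can be dropped from the top without
    changing whether f g is in W. *)
Lemma coef_of_lead : (forall g, W (f (lead_coef g)%:P) -> W (f g)) ->
  forall (g : {poly S}) k, W (f (g`_k)%:P) -> W (f g).
Proof.
have [[W1 WM] W0 WD WMr] := WP; move=> lead g.
have [n] := ubnP (size g); elim: n g => // n IH g; rewrite ltnS => sg k Wk.
have [|Wl] := pselect (W (f (lead_coef g)%:P)); first exact: lead.
pose t := lead_coef g *: 'X^((size g).-1); pose g' := g - t.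
have g0 : (0 < size g)%N.
  rewrite size_poly_gt0; apply/eqP => gE; move: Wk.
  by rewrite gE coef0 rmorph0.
have g'E i : g'`_i = if i == (size g).-1 then 0 else g`_i.
  rewrite coefB coefZ coefXn; case: eqP => [->|_]; last by rewrite mulr0 subr0.
  by rewrite mulr1 lead_coefE subrr.
have Wt : ~ W (f t) by rewrite /t -mul_polyC rmorphM mulrC => /WMr.
have Wg' : W (f g').
  apply: (IH g' _ k).
    apply: leq_trans sg; rewrite -(prednK g0) ltnS; apply/leq_sizeP => i.
    rewrite leq_eqVlt g'E eq_sym; case: eqP => //= _ lt_i.
    by rewrite nth_default // -(prednK g0).
  rewrite g'E; case: eqP => // kE.
  by case: Wl; rewrite lead_coefE -kE.
have := Wg'; rewrite /g' rmorphB => /WD[//|].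
by rewrite -mulN1r => /WMr.
Qed.

End LeadingToAny.

(** If no polynomial in X_(i0) with leading coefficient in W lies in the prime,
    then X_(i0) is transcendental over the residue field of the base and becomes
    part of the base; induction on the number of variables. *)
Theorem top_vanishing_val (d l : nat) (S : idomainType) (B : comNzRingType)
    (j : {rmorphism {mpoly S[d]} -> B}) (W : B -> Prop)
    (a : 'I_l.+1 -> B) (x : B) (nu : nat -> nat) :
  localization_map j -> prime_complement W ->
  locally_val (fun s => W (j s%:MP)) ->
  pro_acyclic a (fun u => u = 1) nu ->
  (forall (i : 'I_l.+1) b, (i < l)%N ->
     gen (initial a i) (a i * b) -> gen (initial a i) b) ->
  (forall b, ~ W b ->
     exists k u, W u /\ gen (initial a l) (u * (b ^+ k * x))) ->
  (forall u, W u -> ~ gen (initial a l) (u * x)) ->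
  kills_top a W.
Proof.
move=> jl WP val wpr a_reg assoc xnz; elim: d S j jl val => [|d IH] S j jl val.
  by apply: (top_vanishing_loc jl WP val _ wpr a_reg assoc xnz) => -[].
have [alg|/existsNP[i0 trans]] := pselect (forall i : 'I_d.+1,
    exists2 g, W (j (lead_coef g)%:MP) & ~ W (j (poly_in_var i g))).
  exact: (top_vanishing_loc jl WP val alg wpr a_reg assoc xnz).
have [[W1 WM] W0 WD WMr] := WP.
apply: (IH {poly S} (j \o unmerge i0)); first exact: localization_map_unmerge.
apply: (locally_val_poly (V := fun s => W (j s%:MP))) => //.
- split=> [|u v Wu Wv]; first by rewrite !rmorph1.
  by rewrite !rmorphM; apply: (WM).
- by rewrite !rmorph0.
- split=> [|u v Wu Wv]; first by rewrite !rmorph1.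
  by rewrite !rmorphM; apply: (WM).
move=> g k; rewrite /= unmergeC -(poly_in_varC i0).
apply: (coef_of_lead (f := j \o poly_in_var i0) WP) => h /=.
rewrite poly_in_varC => Wh.
by apply: contrapT => nWh; apply: trans; exists h.
Qed.

(** * Koszul homology indexed by simplices *)

Section SimplexSums.
Variables (l : nat) (D : nmodType).

Lemma simplex_sum i (F : {set 'I_l} -> D) :
  \sum_(J : simplex l i) F J = \sum_(J : {set 'I_l} | #|J| == i) F J.
Proof.
rewrite [RHS](reindex_omap (@simplex_set l i) insub) => [|J Ji]; last first.
  by case: insubP => [u _ <-|]; rewrite ?Ji.
by apply: eq_bigl => J; rewrite simplexP (valK J) eqxx.
Qed.

Lemma cofacet_sum (I : {set 'I_l}) (F : {set 'I_l} -> D) :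
  \sum_(J : {set 'I_l} | (I \subset J) && (#|J| == #|I|.+1)) F J =
  \sum_(j | j \notin I) F (j |: I).
Proof.
rewrite [RHS](eq_bigl (mem (~: I))) => [|j]; last by rewrite !inE.
rewrite -(big_imset (h := fun j => j |: I)) /=; last first.
  move=> j k; rewrite !inE => jI kI /setP/(_ j).
  rewrite !inE eqxx (negPf jI) orbF /=.
  by rewrite orbF; move/esym/eqP.
apply: eq_bigl => J; apply/andP/imsetP => [[sIJ /eqP cJ]|[j jI ->]].
  have : #|J :\: I| == 1%N by rewrite cardsD (setIidPr sIJ) cJ subSn // subnn.
  case/cards1P => j JI; exists j.
    by have := set11 j; rewrite -JI !inE => /andP[].
  by rewrite -[LHS](setID J I) (setIidPr sIJ) JI setUC.
rewrite inE in jI.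
by rewrite subsetUr cardsU1 jI.
Qed.

Lemma incidence_cofacet (A : pzRingType) (I : {set 'I_l}) j : j \notin I ->
  incidence A I (j |: I) = (-1) ^+ #|[set k in I | (k < j)%N]|.
Proof.
move=> jI; rewrite /incidence subsetUr cardsU1 jI eqxx /=; congr (_ ^+ _).
apply: eq_card => k; rewrite !inE; case: (k \in I) => //=.
apply/existsP/idP => [[i]|kj]; last by exists j; rewrite !inE eqxx jI.
by rewrite !inE; case: eqP => [->|_] /=; [case/andP | case: (i \in I)].
Qed.

End SimplexSums.

Section KoszulComparison.
Variables (A : comNzRingType) (l : nat) (a : l.-tuple A).

Definition extend_zero i (x : koszul A l i) (L : {set 'I_l}) : A :=
  if insub L is Some J then x J else 0.

Lemma extend_zeroE i (x : koszul A l i) (I : simplex l i) :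
  extend_zero x I = x I.
Proof. by rewrite /extend_zero valK. Qed.

Lemma extend_zero_hom i (x : koszul A l i) : khom i (extend_zero x).
Proof. by move=> L Li; rewrite /extend_zero insubF //; apply: negPf. Qed.

Lemma koszul_dE i (x : koszul A l i.+1) (I : simplex l i) :
  koszul_d a i x I = kdiff (tnth a) (extend_zero x) I.
Proof.
rewrite ffunE.
under eq_bigr do rewrite -extend_zeroE.
rewrite (simplex_sum _ (fun J =>
  incidence A I J * (\prod_(k in J :\: I) tnth a k) * extend_zero x J)).
rewrite (bigID (fun J : {set 'I_l} => I \subset J)) /= addrC.
rewrite big1 ?add0r; last first.
  by move=> J /andP[_ /negPf sIJ]; rewrite /incidence sIJ !mul0r.
rewrite (eq_bigl (fun J : {set 'I_l} => (I \subset J) && (#|J| == #|I|.+1))).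
  rewrite cofacet_sum; apply: eq_bigr => j jI; rewrite incidence_cofacet //.
  congr (_ * _ * _); rewrite (_ : _ :\: _ = [set j]) ?big_set1 //.
  apply/setP=> k; rewrite !inE; case: eqP => [->|_]; first by rewrite jI.
  by case: (k \in I).
by move=> J; rewrite (eqP (simplexP I)) andbC.
Qed.

End KoszulComparison.

Lemma weakly_proregular_pro_zero (A : comNzRingType) (l : nat)
    (a : l.-tuple A) :
  weakly_proregular a -> exists nu, pro_acyclic (tnth a) (fun u => u = 1) nu.
Proof.
move=> wpr.
suff /choice[nu nuP] : forall n, exists N, (0 < n)%N -> (n <= N)%N /\
    pro_zero (tnth a) (fun u => u = 1) n N 0 (@zero_ideal A) (@unit_ideal A).
  by exists nu.
move=> n; case: (posnP n) => [->|/wpr[N [nN H]]]; first by exists 0%N.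
exists N => _; split=> // -[//|i] z _ hz _ dz.
have powE k m : tnth (powseq a m) k = apow (tnth a) m k by rewrite tnth_map.
have powE' m w L : kdiff (tnth (powseq a m)) w L = kdiff (apow (tnth a) m) w L.
  by apply: eq_bigr => k _; rewrite powE.
pose x : koszul A l i.+1 := [ffun I : simplex l i.+1 => z I].
have xz : extend_zero x = z.
  apply/funext => L; rewrite /extend_zero.
  by case: insubP => [I _ <-|Li]; [rewrite ffunE | rewrite hz].
have kx : x \in kernel
    [the {linear _ -> _} of @koszul_d A l (powseq a N) i.+1 i].
  rewrite inE; apply/eqP/ffunP => I; rewrite [LHS]koszul_dE xz powE' ffunE.
  exact: dz.
have := H i.+1 isT (hclass
  [the {linear _ -> _} of @koszul_d A l (powseq a N) i.+2 i.+1] kx).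
rewrite /koszul_homology_map /hclass.
rewrite (homology_mapE _ (phi1 := @koszul_map A l a n N i.+2)); last first.
  by move=> y; rewrite /= koszul_map_d.
rewrite -[RHS](raddf0 (quotmod_class _)) => /quotmod_classP.
rewrite subr0 inE => /asboolP[y /= dy].
exists 1, (extend_zero y); split=> //; first exact: extend_zero_hom.
move=> L; rewrite mul1r /zero_ideal.
have [Li|Li] := eqVneq #|L| i.+1; last first.
  by rewrite (ktrans_hom _ _ hz) ?(kdiff_hom _ (extend_zero_hom y)) ?subrr.
have LiP : #|L| == i.+1 by apply/eqP.
have := congr1 (fun f : {ffun simplex l i.+1 -> A^o} => f (Simplex LiP)) dy.
by rewrite koszul_dE powE' => /= ->; rewrite ffunE /ktrans ffunE subrr.
Qed.

(** * Top Cech cohomology *)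

Section Cech.
Variables (B : comNzRingType) (l : nat) (a : l.+1.-tuple B).

Lemma locfrac_add (S : mulrClosed B) (M : lmodType B) (m n : M) (s : denom S) :
  locfrac (m + n) s = locfrac m s + locfrac n s.
Proof. by rewrite locfracD; apply: locfrac_eq; rewrite -scalerDr scalerA. Qed.

Lemma locfrac_sum (S : mulrClosed B) (M : lmodType B) (J : Type) (r : seq J)
    (F : J -> M) (s : denom S) :
  locfrac (\sum_(j <- r) F j) s = \sum_(j <- r) locfrac (F j) s.
Proof.
elim: r => [|j r IH]; last by rewrite !big_cons locfrac_add IH.
rewrite !big_nil -[RHS]/(locfrac (0 : M) (denom1 S)).
by apply: locfrac_eq; rewrite !scaler0.
Qed.

Definition face_prod (I : {set 'I_(l.+1)}) : B := \prod_(k in I) tnth a k.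

Lemma face_powP I N : face_prod I ^+ N \in powers (face_prod I).
Proof. by rewrite inE; apply/asboolP; exists N. Qed.

Definition face_pow I N : denom (powers (face_prod I)) := Denom (face_powP I N).

Lemma cech_face_cofacet (I J : {set 'I_(l.+1)}) i (m : B^o) N :
  i \notin I -> J = i |: I ->
  cech_face J (locfrac m (face_pow I N) : cech_loc a B^o I) =
  locfrac (tnth a i ^+ N * m : B^o) (face_pow J N).
Proof.
move=> iI JE; rewrite /cech_face; case: {-}_ / idP => [sIJ|]; last first.
  by rewrite JE subsetUr.
rewrite locmapE; apply: locfrac_eq; rewrite locmap_denomE /=.
have -> : face_prod J = tnth a i * face_prod I.
  by rewrite /face_prod JE big_setU1.
set u := locmap_mult _ _.
rewrite -[LHS]/((tnth a i * face_prod I) ^+ N * (u * m)).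
rewrite -[RHS]/((u * face_prod I ^+ N) * (tnth a i ^+ N * m)).
by rewrite exprMn; ring.
Qed.

(** A top cochain is a fraction m / p^k, where p is the product of all a_i.
    With u p^(N-k-1) = sum of the c_i a_i^N, the multiple u m / p^k is the sum
    of the m p c_i a_i^N / p^N, and the i-th summand comes from the face without
    i. *)
Lemma cech_top_boundary (x : cech a B^o l.+1) (W : B -> Prop) :
  kills_top (tnth a) W ->
  exists u (y : cech a B^o l), W u /\ u *: x = cech_d l.+1 y.
Proof.
move=> van; have cT : #|[set: 'I_(l.+1)]| == l.+1 by rewrite cardsT card_ord.
pose T : simplex l.+1 l.+1 := Simplex cT.
have prodT : face_prod T = \prod_k tnth a k.
  by rewrite /face_prod; apply: eq_bigl => k; rewrite inE.
have [m [k xT]] : exists (m : B^o) k, x T = locfrac m (face_pow T k).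
  elim/locfracW: (x T) => m s; have := denomP s; rewrite inE => /asboolP[k sE].
  by exists m, k; apply: locfrac_eq; rewrite /= sE.
(* The exponent k + 1 rather than k, since kills_top needs a positive one. *)
have [N [u [kN Wu /genP[c cE]]]] := van k.+1 isT.
pose mc i : B^o := m * (\prod_k tnth a k) * c i.
(* The sign of the face cancels against that of the Cech differential. *)
pose y : cech a B^o l := [ffun I : simplex l.+1 l =>
  incidence B I T *: \sum_(i | i \notin (I : {set 'I_(l.+1)}))
    (locfrac (mc i) (face_pow I N) : cech_loc a B^o I)].
exists u, y; split=> //; apply/ffunP => J.
have -> : J = T.
  apply/val_inj/eqP; rewrite eqEcard subsetT /=.
  by rewrite (eqP (simplexP J)) cardsT card_ord.
rewrite dprodZ xT ffunE.
pose F i : cech_loc a B^o T :=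
  locfrac (tnth a i ^+ N * mc i : B^o) (face_pow T N).
have incT (I : simplex l.+1 l) : incidence B I T * incidence B I T = 1.
  rewrite /incidence subsetT /= cardsT card_ord (eqP (simplexP I)) eqxx.
  by rewrite -expr2 sqrr_sign.
have cof (I : simplex l.+1 l) i :
    i \notin (I : {set _}) -> simplex_set T = i |: I.
  move=> iI; apply/esym/eqP; rewrite eqEcard subsetT cardsT card_ord.
  by rewrite cardsU1 iI (eqP (simplexP I)) add1n leqnn.
have -> : \sum_(I : simplex l.+1 l) incidence B I T *: cech_face T (y I) =
    \sum_(I : simplex l.+1 l) \sum_(i | i \notin (I : {set _})) F i.
  apply: eq_bigr => I _; rewrite ffunE linearZ scalerA incT scale1r linear_sum.
  by apply: eq_bigr => i iI; apply: cech_face_cofacet iI (cof _ _ iI).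
rewrite (exchange_big_dep xpredT) //=.
have -> : \sum_i \sum_(I : simplex l.+1 l | i \notin (I : {set _})) F i =
    \sum_i F i.
  apply: eq_bigr => i _.
  have ci : #|[set~ i]| == l by rewrite cardsC1 card_ord.
  rewrite (big_pred1 (Simplex ci)) // => I /=.
  apply/idP/eqP => [iI|->]; last by rewrite !inE eqxx.
  apply/val_inj/eqP; rewrite /= eqEcard (eqP ci) (eqP (simplexP I)) leqnn.
  rewrite andbT; apply/subsetP => j jI; rewrite !inE.
  apply: contraNneq iI => <-.
  exact: jI.
rewrite /F -locfrac_sum locfracZ; apply: locfrac_eq.
rewrite /= prodT.
set p := \prod_k tnth a k in cE *.
have -> : \sum_i (tnth a i ^+ N * mc i : B^o) =
    m * p * (u * p ^+ (N - k.+1)) :> B.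
  rewrite cE mulr_sumr; apply: eq_bigr => i _.
  by rewrite [LHS]mulrC -[LHS]mulrA.
rewrite -[LHS]/(p ^+ N * (u * m)).
rewrite -[RHS]/(p ^+ k * (m * p * (u * p ^+ (N - k.+1)))).
have -> : p ^+ N = p ^+ k * p * p ^+ (N - k.+1).
  by rewrite -exprSr -exprD subnKC.
by ring.
Qed.

Lemma top_cech_localized_zero (P : prime_idealr B) :
  kills_top (tnth a) (fun u => u \notin P) ->
  forall h : modloc_prime P (cech_cohomology a B^o l.+1), h = 0.
Proof.
move=> van; elim/locfracW => h s; elim/quotmod_classW: h => z.
have [u [y [Pu uE]]] := cech_top_boundary (\val z) van.
apply/locfracP; exists (@Denom _ (prime_compl P) u Pu) => /=.
rewrite scale1r !scaler0.
rewrite -[RHS](raddf0 (quotmod_class _)) -linearZ; apply/quotmod_classP.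
rewrite subr0 inE; apply/asboolP; exists y.
by rewrite /= -uE.
Qed.

End Cech.

(** * Primes minimal over an ideal *)

Section MinimalPrime.
Variables (B : comNzRingType) (I : B -> Prop).
Hypotheses (idI : ideal I) (I1 : ~ I 1).

(** The multiplicative set generated by W is disjoint from I.  Quantifying over
    finite lists makes the condition inductive for unions of chains. *)
Definition avoids (W : B -> Prop) : Prop :=
  forall s : seq B, (forall b, b \in s -> W b) -> ~ I (\prod_(b <- s) b).

Lemma maximal_avoiding : exists W, avoids W /\
  forall b, ~ W b -> exists2 s : seq B, (forall c, c \in s -> W c) &
    exists k, I (\prod_(c <- s) c * b ^+ k).
Proof.
have [F FP tot|W [WP Wmax]] := @classical_sets.Zorn_bigcup B avoids.
  move=> s sF; suff [->|[X [FX sX]]] : s = [::] \/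
      exists X, F X /\ forall b, b \in s -> X b.
    by rewrite big_nil.
  - exact: (FP X FX s sX).
  elim: s sF => [|b s IH] sF; first by left.
  right; have [X FX Xb] := sF b (mem_head _ _).
  have [c cs|->|[Y [FY sY]]] := IH.
  - by apply: sF; rewrite inE cs orbT.
  - by exists X; split=> // c; rewrite inE => /eqP ->.
  have [XY|YX] := tot X Y FX FY.
    by exists Y; split=> // c; rewrite inE => /predU1P[->|/sY//]; apply: XY.
  by exists X; split=> // c; rewrite inE => /predU1P[->//|/sY]; apply: YX.
exists W; split=> // b Wb.
have : ~ avoids (fun c => W c \/ c = b).
  apply: Wmax; split; first by move=> c; left.
  by move=> sub; apply: Wb; apply: sub; right.
move=> /existsNP[s /not_implyP[sW /contrapT Is]].
suff [s' s'W [k sE]] : exists2 s' : seq B, (forall c, c \in s' -> W c) &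
    exists k, \prod_(c <- s) c = \prod_(c <- s') c * b ^+ k.
  by exists s' => //; exists k; rewrite -sE.
elim: s sW {Is} => [|c s IH] sW.
  by exists [::] => //; exists 0%N; rewrite !big_nil mul1r.
have [|s' s'W [k sE]] := IH.
  by move=> e es; apply: sW; rewrite inE es orbT.
have [Wc|->] := sW c (mem_head _ _).
  exists (c :: s'); last by exists k; rewrite !big_cons sE mulrA.
  by move=> e; rewrite inE => /predU1P[->|/s'W].
by exists s' => //; exists k.+1; rewrite big_cons sE exprS mulrCA.
Qed.

(** The complement of a multiplicative set W that is maximal among those
    disjoint from I is a prime, minimal over I: by maximality, adding to W an
    element b outside of it produces some u b^k in I. *)
Theorem minimal_prime : exists W, [/\ prime_complement W,
  forall b, W b -> ~ I b
  & forall b, ~ W b -> exists k u, W u /\ I (u * b ^+ k)].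
Proof.
have [W [WP Wmax]] := maximal_avoiding.
have W1 : W 1.
  apply: contrapT => /Wmax[s sW [k]]; rewrite expr1n mulr1.
  exact: WP.
have WM u v : W u -> W v -> W (u * v).
  move=> Wu Wv; apply: contrapT => /Wmax[s sW [k]].
  have -> : \prod_(c <- s) c * (u * v) ^+ k =
      \prod_(c <- s ++ nseq k u ++ nseq k v) c.
    by rewrite !big_cat !big_nseq -!/(iter _ _ _) !iter_mulr_1 exprMn.
  apply: WP => c; rewrite !mem_cat !mem_nseq.
  by move=> /or3P[/sW//|/andP[_ /eqP->]|/andP[_ /eqP->]].
have Wprod (s : seq B) : (forall c, c \in s -> W c) -> W (\prod_(c <- s) c).
  elim: s => [|c s IH] sW; first by rewrite big_nil.
  rewrite big_cons; apply: WM; first by apply: sW; rewrite mem_head.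
  by apply: IH => e es; apply: sW; rewrite inE es orbT.
have WI b : W b -> ~ I b.
  move=> Wb; have := WP [:: b]; rewrite big_seq1; apply=> c.
  by rewrite inE => /eqP ->.
have WC b : ~ W b -> exists k u, W u /\ I (u * b ^+ k).
  move=> /Wmax[s sW [k Ik]]; exists k, (\prod_(c <- s) c).
  by split=> //; apply: Wprod.
have WX b k : W b -> W (b ^+ k).
  by move=> Wb; elim: k => [|k IH]; rewrite ?expr0 // exprS; apply: (WM).
exists W; split=> //; split=> //.
- by move=> W0; apply: (WI 0) => //; apply: ideal0.
- move=> x y Wxy; apply: contrapT => /not_orP[].
  move=> /WC[k [u [Wu Ix]]] /WC[m [v [Wv Iy]]].
  apply: (WI (u * v * (x + y) ^+ (k + m))).
    by apply: (WM); [apply: (WM) | apply: WX].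
  rewrite exprDn mulr_sumr; apply: ideal_sum => // i _.
  rewrite -mulr_natr; have [mi|im] := leqP m i.
    rewrite -(subnK mi) exprD.
    set e := (i - m)%N; set X := x ^+ _.
    have -> : u * v * (X * (y ^+ e * y ^+ m) * 'C(k + m, e + m)%:R) =
      u * X * y ^+ e * 'C(k + m, e + m)%:R * (v * y ^+ m) by ring.
    exact: idealM.
  have ki : (k <= k + m - i)%N by rewrite -addnBA ?leq_addr // ltnW.
  rewrite -(subnK ki) exprD.
  set e := (_ - k)%N.
  have -> : u * v * (x ^+ e * x ^+ k * y ^+ i * 'C(k + m, i)%:R) =
    v * x ^+ e * y ^+ i * 'C(k + m, i)%:R * (u * x ^+ k) by ring.
  exact: idealM.
- move=> x y Wxy; apply: contrapT => /WC[k [u [Wu Iy]]].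
  apply: (WI (u * (x * y) ^+ k)); first by apply: (WM) => //; apply: WX.
  by rewrite exprMn mulrCA; apply: idealM.
Qed.

End MinimalPrime.

Section PrimeOfComplement.
Variables (B : comNzRingType) (W : B -> Prop) (WP : prime_complement W).

Definition prime_of : pred B := fun b => `[< ~ W b >].

Lemma prime_ofP b : reflect (~ W b) (b \in prime_of).
Proof. exact: asboolP. Qed.

Lemma prime_of_idealr : idealr_closed prime_of.
Proof.
have [[W1 WM] W0 WD WMr] := WP; split; first exact/prime_ofP.
  by apply/negP => /prime_ofP.
move=> c u v /prime_ofP Wu /prime_ofP Wv; apply/prime_ofP => /WD[/WMr|] //.
Qed.

Lemma prime_of_prime : prime_idealr_closed prime_of.
Proof.
have [[W1 WM] W0 WD WMr] := WP; move=> u v /prime_ofP Wuv.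
apply/orP; have [Wu|Wu] := pselect (W u); last by left; apply/prime_ofP.
by right; apply/prime_ofP => Wv; apply: Wuv; apply: WM.
Qed.

HB.instance Definition _ := isIdealr.Build B prime_of prime_of_idealr.
HB.instance Definition _ := isPrimeIdealrClosed.Build B prime_of prime_of_prime.

Definition prime_ideal_of : prime_idealr B := prime_of.

End PrimeOfComplement.

(** * Prufer domains and valuation domains at a prime *)

Lemma pc_sum (B : comNzRingType) (W : B -> Prop) (J : Type) (r : seq J)
    (F : J -> B) :
  prime_complement W -> W (\sum_(k <- r) F k) -> exists k, W (F k).
Proof.
move=> WP; elim: r => [|k r IH]; first by rewrite big_nil => /(pc_0 WP).
by rewrite big_cons => /(pc_add WP)[|/IH//]; exists k.
Qed.

(** If J is inverse to I = (f, g), then 1 is a sum of products x v with x in I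
    and v in J, and some r = x v is outside the prime.  Writing x = c f + c' g
    one gets r = c (f v) + c' (g v) with f v and g v in R, so one of these is
    outside the prime; and (f v) g = (g v) f. *)
Lemma prufer_locally_val (R : idomainType) (V : R -> Prop) :
  prufer_domain R -> prime_complement V -> locally_val V.
Proof.
move=> pruf VP f g; have [V1 VM] := pc_mult VP.
have [->|f0] := eqVneq f 0.
  by exists 1, 0; split=> //; left; rewrite mulr0 mul0r.
pose s := [:: f; g].
have [|J Jsub Jinv] := pruf s; first by exists f; rewrite // mem_head.
have in_s x v : ideal_gen s x -> J v -> exists r, tofrac x * v = tofrac r.
  move=> sx Jv; have [|r _ ->] := proj1 (Jinv (tofrac x * v)); last by exists r.
  exists 1%N, (fun=> tofrac x), (fun=> v); split; last by rewrite big_ord1.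
  by split=> //; exists x.
have sf : ideal_gen s f.
  exists (fun i => (i == ord0)%:R).
  by rewrite !big_ord_recl big_ord0 /= mul1r mul0r !addr0.
have sg : ideal_gen s g.
  exists (fun i => (i != ord0)%:R).
  by rewrite !big_ord_recl big_ord0 /= mul1r mul0r add0r addr0.
have [|n [u [v [uv one]]]] := proj2 (Jinv 1).
  by exists 1; rewrite // rmorph1.
have /choice[r rE] : forall k, exists r, u k * v k = tofrac r.
  by move=> k; have [[x sx ->] Jv] := uv k; apply: in_s.
have [k Vr] : exists k, V (r k).
  apply: (pc_sum (r := index_enum 'I_n)) => //.
  suff <- : 1 = \sum_k r k by [].
  apply/eqP; rewrite -tofrac_eq rmorph1 one rmorph_sum; apply/eqP.
  by apply: eq_bigr.
have [[x [c xE] uE] Jv] := uv k.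
have [p pE] := in_s f (v k) sf Jv; have [q qE] := in_s g (v k) sg Jv.
have pgE : p * g = q * f.
  by apply/eqP; rewrite -tofrac_eq !rmorphM /= -pE -qE; apply/eqP; ring.
have rkE : r k = c ord0 * p + c (lift ord0 ord0) * q.
  apply/eqP; rewrite -tofrac_eq rmorphD !rmorphM /= -pE -qE -rE uE xE.
  rewrite !big_ord_recl big_ord0 /= addr0 rmorphD !rmorphM /=.
  by apply/eqP; ring.
move: Vr; rewrite rkE => /(pc_add VP)[/(pc_mul VP) Vp|/(pc_mul VP) Vq].
  by exists p, q; split=> //; right.
by exists q, p; split=> //; left.
Qed.

Lemma valuation_locally_val (R : idomainType) (V : R -> Prop) :
  valuation_domain R -> V 1 -> locally_val V.
Proof.
move=> val V1 f g.
have [->|f0] := eqVneq f 0.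
  by exists 1, 0; split=> //; left; rewrite mulr0 mul0r.
have [->|g0] := eqVneq g 0.
  by exists 1, 0; split=> //; right; rewrite mulr0 mul0r.
have f0' : tofrac f != 0 by rewrite tofrac_eq0.
have g0' : tofrac g != 0 by rewrite tofrac_eq0.
have [|[h _ hE]|[h _ hE]] := val (tofrac f / tofrac g).
- by rewrite mulf_neq0 ?invr_eq0.
- exists 1, h; split=> //; left; apply/eqP.
  by rewrite mul1r -tofrac_eq rmorphM /= -hE divfK.
- exists 1, h; split=> //; right; apply/eqP.
  by rewrite mul1r -tofrac_eq rmorphM /= -hE invf_div divfK.
Qed.

(** * The localization at a prime *)

Section LocPrime.
Variables (A : idomainType) (P : prime_idealr A).

Definition to_locprime (a : A) : locprime P :=
  locfrac (a : A^o) (denom1 (prime_compl P)).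

Lemma to_locprime_zmod : zmod_morphism to_locprime.
Proof.
move=> a b; pose s := denom1 (prime_compl P).
have E : locfrac (a : A^o) s - locfrac (b : A^o) s = locfrac (a - b : A^o) s.
  have -> : - locfrac (b : A^o) s = locfrac (- b : A^o) s by exact: loc_oppE.
  by rewrite -locfrac_add.
by rewrite [RHS]E.
Qed.

Lemma to_locprime_monoid : monoid_morphism to_locprime.
Proof.
split=> // a b; rewrite /to_locprime.
rewrite -[RHS]/(locring_mul _ _) locring_mulE; apply: locfrac_eq.
by rewrite /= mul1r.
Qed.

HB.instance Definition _ :=
  GRing.isZmodMorphism.Build A (locprime P) to_locprime to_locprime_zmod.
HB.instance Definition _ :=
  GRing.isMonoidMorphism.Build A (locprime P) to_locprime to_locprime_monoid.

Lemma to_locprime_localization : localization_map to_locprime.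
Proof.
split=> [a b /locfracP[u /=]|].
  rewrite !scale1r => /mulfI -> //.
  by apply: contraTneq (denomP u) => ->; rewrite inE negbK idealr0.
elim/locfracW => m s; exists (denom_val s), (m : A); split.
  exists (locfrac (1 : A^o) s).
  rewrite -[LHS]/(locring_mul _ _) locring_mulE; apply: locfrac_eq.
  by rewrite /= scale1r mul1r.
rewrite -[LHS]/(locring_mul _ _) locring_mulE; apply: locfrac_eq.
by rewrite /= scale1r mul1r.
Qed.

End LocPrime.

(** * Parameter sequences are regular *)

Section Sequences.
Variable B : comNzRingType.

Lemma ideal_gen_initial (s : seq B) (k : nat) (x : B) : size s = k ->
  ideal_gen s x <-> gen (initial (tnth (in_tuple s)) k) x.
Proof.
move=> <-; rewrite genP /ideal_gen.
by split=> -[c ->]; exists c; apply: eq_bigr => i _; rewrite (tnth_nth 0).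
Qed.

Lemma initial_take (m l : nat) (b : m.-tuple B) (a : l.-tuple B) (k : nat) :
  (k <= m)%N -> (k <= l)%N -> take k b = take k a ->
  initial (tnth b) k = initial (tnth a) k.
Proof.
move=> km kl E; apply/funext => h; apply/propext.
suff sub (m' l' : nat) (b' : m'.-tuple B) (a' : l'.-tuple B) :
    (k <= l')%N -> take k b' = take k a' ->
    initial (tnth b') k h -> initial (tnth a') k h.
  by split; apply: sub.
move=> kl' E' [j jk ->]; exists (Ordinal (leq_trans jk kl')) => //.
by rewrite !(tnth_nth 0) /= -(nth_take _ jk) E' nth_take.
Qed.

Lemma ideal_gen_take (l : nat) (a : l.-tuple B) k x : (k <= l)%N ->
  ideal_gen (take k a) x <-> gen (initial (tnth a) k) x.
Proof.
move=> kl; rewrite (@ideal_gen_initial _ k) ?size_takel ?size_tuple //.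
rewrite (initial_take (a := a)) ?size_takel ?size_tuple //=.
by rewrite take_takel.
Qed.

Lemma ideal_gen_tuple (l : nat) (a : l.-tuple B) x :
  ideal_gen a x <-> gen (initial (tnth a) l) x.
Proof. by rewrite -ideal_gen_take // take_oversize ?size_tuple. Qed.

End Sequences.

(** W is the complement of a prime minimal over ((a_0, ..., a_(l-1)) : x).  It
    contains a_l and the other a_i, so the top cohomology does not vanish there
    by definition of a parameter sequence, but does by the vanishing theorem. *)
Theorem parameter_regular (n : nat) (R : idomainType) (B : comNzRingType)
    (j : {rmorphism {mpoly R[n]} -> B}) :
  localization_map j ->
  (forall V, prime_complement V -> @locally_val R V) ->
  forall (m l : nat) (a : m.-tuple B), m = l.+1 ->
  parameter_sequence a ->
  (forall (i : 'I_m) b, (i < l)%N ->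
     gen (initial (tnth a) i) (tnth a i * b) -> gen (initial (tnth a) i) b) ->
  forall (i : 'I_m) x, i = l :> nat ->
     gen (initial (tnth a) l) (tnth a i * x) -> gen (initial (tnth a) l) x.
Proof.
move=> jl val m l a mE; case: _ / (esym mE) a => a [_ wpr top] a_reg i x il Hx.
apply: contrapT => nx.
pose I y := gen (initial (tnth a) l) (y * x).
have idI : ideal I.
  have idg := gen_ideal (initial (tnth a) l).
  split=> [|y z Iy Iz|r y Iy]; rewrite /I.
  - by rewrite mul0r; apply: ideal0.
  - by rewrite mulrDl; apply: idealD.
  - by rewrite -mulrA; apply: idealM.
have [|W [WP WI Wassoc]] := minimal_prime idI; first by rewrite /I mul1r.
have [nu nuP] := weakly_proregular_pro_zero wpr.
have [W1 WM] := pc_mult WP.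
have van : kills_top (tnth a) W.
  apply: (top_vanishing_val jl WP _ nuP a_reg (x := x)) => //.
  - apply: val; have [_ W0 WD WMr] := WP; split=> [||y z|y z].
    + split=> [|y z Wy Wz]; first by rewrite !rmorph1.
      by rewrite !rmorphM; apply: WM.
    + by rewrite !rmorph0.
    + by rewrite !rmorphD; apply: WD.
    + by rewrite !rmorphM; apply: WMr.
  - move=> b /Wassoc[k [u [Wu Iu]]]; exists k, u; split=> //.
    by rewrite mulrA.
have [|h] := top (prime_ideal_of WP).
  move=> y Hy; apply/prime_ofP => /WI; apply.
  have {}Hy := proj1 (ideal_gen_tuple a y) Hy.
  apply: (gen_min idI) Hy => _ [k kl ->].
  have [kl'|] := ltnP k l.
    apply: ideal_mulr; first exact: gen_ideal.
    by apply: gen_in; exists k.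
  rewrite leq_eqVlt ltnNge -ltnS kl orbF => /eqP lk.
  by rewrite /I (_ : k = i) //; apply/val_inj/esym; exact: (etrans il lk).
suff -> : h = 0 by rewrite eqxx.
apply: top_cech_localized_zero => k k0.
have [N [u [kN Wu Hu]]] := van k k0; exists N, u; split=> //.
by apply/negP => /prime_ofP; apply.
Qed.

(** Regularity of the members of a strong parameter sequence is proved one after
    the other, each time for the initial segment ending there. *)
Theorem localization_cohen_macaulay (n : nat) (R : idomainType)
    (B : comNzRingType) (j : {rmorphism {mpoly R[n]} -> B}) :
  localization_map j ->
  (forall V, prime_complement V -> @locally_val R V) ->
  cohen_macaulay B.
Proof.
move=> jl val l a strong; split.
  case: l a strong => [|l] a strong.
    by exists 1 => /ideal_gen_tuple/initial0/eqP; apply/negP/oner_neq0.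
  have [|prop _ _] := strong l.+1; first by rewrite leqnn.
  by move: prop; rewrite /= take_oversize ?size_tuple.
suff reg k : forall (i : 'I_l) x, (i < k)%N ->
    gen (initial (tnth a) i) (tnth a i * x) -> gen (initial (tnth a) i) x.
  move=> i x; have il := ltnW (ltn_ord i).
  by rewrite !ideal_gen_take //; apply: (reg i.+1).
elim: k => // k IH i x; rewrite ltnS leq_eqVlt => /predU1P[ik|]; last exact: IH.
have kl : (k < l)%N by rewrite -ik.
have mE : minn k.+1 l = k.+1 by apply/minn_idPl.
have [|_ wpr top] := strong k.+1; first by rewrite kl.
have E e : (e <= k.+1)%N ->
    initial (tnth [tuple of take k.+1 a]) e = initial (tnth a) e.
  move=> ek; apply: initial_take; rewrite ?mE ?(leq_trans ek) //=.
  by rewrite take_takel.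
have Et (i' : 'I_(minn k.+1 l)) (i'' : 'I_l) : i' = i'' :> nat ->
    tnth [tuple of take k.+1 a] i' = tnth a i''.
  move=> ii; rewrite !(tnth_nth 0) /= nth_take ?ii //.
  by rewrite -ii -[X in (_ < X)%N]mE.
have ltk : (k < minn k.+1 l)%N by rewrite mE.
rewrite ik -(E k) // -(Et (Ordinal ltk) i) //.
apply: (parameter_regular jl val mE) => //; first exact: strong.
move=> i' b ik'; have i'l := ltn_trans ik' kl.
rewrite E; last exact: leqW (ltnW ik').
rewrite (Et i' (Ordinal i'l)) //.
exact: (IH (Ordinal i'l)).
Qed.

Theorem theorem3 :
  (forall (R : idomainType) (n : nat),
     prufer_domain R -> finite_krull_dim R ->
     (forall P : prime_idealr {mpoly R[n]}, cohen_macaulay (locprime P)) /\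
     cohen_macaulay {mpoly R[n]}) /\
  (forall (V : idomainType) (n : nat),
     valuation_domain V -> cohen_macaulay {mpoly V[n]}).
Proof.
have idl (A : idomainType) : localization_map (idfun : {rmorphism A -> A}).
  by split=> // b; exists 1, b; split; [exists 1|]; rewrite mul1r.
split=> [R n pruf _|V n val].
  have lv V : prime_complement V -> @locally_val R V.
    exact: prufer_locally_val.
  split=> [P|]; last exact: (localization_cohen_macaulay (idl _) lv).
  exact: (localization_cohen_macaulay (to_locprime_localization P) lv).
apply: (localization_cohen_macaulay (idl _)) => W WP.
by apply: valuation_locally_val val _; case: (pc_mult WP).
Qed.
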